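(* Let $f\in C^2([0,1])$ satisfy $f(0)=f(1)=0$, $0<f(s)\le f'(0)s$ for all $s\in(0,1)$, and suppose $s\mapsto f(s)/s$ is nonincreasing on $(0,1]$; extend $f$ linearly to $\mathbb{R}\setminus[0,1]$. Let $\lambda_*=\sqrt{f'(0)}$, fix $\lambda\in(0,\lambda_* )$, set $c=\lambda+f'(0)/\lambda$, and let $U_c$ be a traveling front profile of speed $c$. Let $u_0:\mathbb{R}\to[0,1]$ be continuous and not identically zero, and suppose there exist $\nu\in\mathbb{R}$ and $a>0$ such that $u_0(x)=ax^{\nu}e^{-\lambda x}$ for all sufficiently large $x$. Let $u$ be the solution of $u_t=u_{xx}+f(u)$, $t>0$, $x\in\mathbb{R}$, with $u(0,\cdot)=u_0$. Then there exists $\sigma_\infty\in\mathbb{R}$ (depending on $u_0$) such that $\lim_{t\to+\infty}\sup_{x\ge0}\big|u(t,x)-U_c\big(x-ct-\frac{\nu}{\lambda}\ln t-\sigma_\infty\big)\big|=0.$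
   Context: ''Extended linearly'' means $f$ is extended to $\mathbb{R}$ by affine functions outside $[0,1]$. A traveling front of speed $c$ is a decreasing function $U_c:\mathbb{R}\to(0,1)$ with $U_c''+cU_c'+f(U_c)=0$, $U_c(-\infty)=1$, $U_c(+\infty)=0$; for $c\ge 2\sqrt{f'(0)}$ such fronts exist and are unique up to translation; $U_c$ denotes a fixed one. *)

(* Defs.v *)
From Stdlib Require Import Reals.
From Coquelicot Require Import Coquelicot.
Open Scope R_scope.

(* g is C^2 on all of R. A function in C^2([0,1]) is exactly the restriction
   to [0,1] of such a g (standard C^2 extension). *)
Definition C2_on_R (g : R -> R) : Prop :=
  (forall x, ex_derive g x) /\
  (forall x, ex_derive (Derive g) x) /\
  (forall x, continuous (Derive (Derive g)) x).

(* Linear (C^1, tangent) extension of g|[0,1] to R. Since g(0)=g(1)=0 in the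
   theorem, this is f(s) = f'(0) s for s<0 and f(s) = f'(1)(s-1) for s>1. *)
Definition lin_ext (g : R -> R) (s : R) : R :=
  if Rlt_dec s 0 then g 0 + Derive g 0 * s
  else if Rlt_dec 1 s then g 1 + Derive g 1 * (s - 1)
  else g s.

Definition is_front (f : R -> R) (c : R) (U : R -> R) : Prop :=
  (forall x, 0 < U x < 1) /\
  (forall x y, x < y -> U y < U x) /\
  (forall x, ex_derive U x) /\
  (forall x, ex_derive (Derive U) x) /\
  (forall x, Derive (Derive U) x + c * Derive U x + f (U x) = 0) /\
  is_lim U m_infty 1 /\
  is_lim U p_infty 0.

Definition classical_solution (f : R -> R) (u0 : R -> R) (u : R -> R -> R) : Prop :=
  (forall t x, 0 <= t -> forall eps, 0 < eps -> exists delta, 0 < delta /\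
     forall s y, 0 <= s -> Rabs (s - t) < delta -> Rabs (y - x) < delta ->
       Rabs (u s y - u t x) < eps) /\
  (forall t x, 0 < t ->
     ex_derive (fun s => u s x) t /\
     ex_derive (fun y => u t y) x /\
     ex_derive (fun y => Derive (fun z => u t z) y) x) /\
  (forall t x, 0 < t -> forall eps, 0 < eps -> exists delta, 0 < delta /\
     forall s y, 0 < s -> Rabs (s - t) < delta -> Rabs (y - x) < delta ->
       Rabs (Derive (fun r => u r y) s - Derive (fun r => u r x) t) < eps /\
       Rabs (Derive (fun w => Derive (fun z => u s z) w) y
             - Derive (fun w => Derive (fun z => u t z) w) x) < eps) /\
  (forall t x, 0 < t ->
     Derive (fun s => u s x) t
     = Derive (fun y => Derive (fun z => u t z) y) x + f (u t x)) /\
  (forall x, u 0 x = u0 x) /\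
  (exists M, forall t x, 0 <= t -> Rabs (u t x) <= M).

(* Main.v *)
Require Import Defs.
From Stdlib Require Import Reals Lra Psatz Classical ClassicalEpsilon FunctionalExtensionality.
From Coquelicot Require Import Coquelicot.
Open Scope R_scope.

(** Since [f(s)/s] is nonincreasing, if [w] solves [w_t = w_xx + f'(0) w] then
    [(1+e) U + w] is a supersolution and [(1-e) U - w] a subsolution. For a
    fixed final time [T], the exponential profile of the front shifted by
    [(nu/lambda) ln T + sigma] agrees with [u0] near [x = d T], where
    [d = f'(0)/lambda - lambda]; everywhere else the mismatch is dominated by
    two exponentials of rates [lambda +- eta] which, evolved linearly, are
    exponentially small at time [T] for [x >= (c - beta) T]. This gives the
    convergence there, with no need to know the front at other times. Behind,
    a small compactly supported bump spreads at positive speed and the reaction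
    then lifts [u] to 1. *)

(** * Maximum principle on a strip *)

(** The value of [d] is a group velocity effect. Under the linear equation the mode of rate [b]
    becomes [exp (- b x + (b^2 + f'(0)) t)]: rate [lambda] has phase speed [c], but packets of
    nearby rates move at speed [2 lambda]. What reaches [x = c T] at time [T] thus started near
    [(c - 2 lambda) T = d T], and [lambda^2 < f'(0)] makes [d] positive. There [x^nu] is close to
    [(d T)^nu]; matching [a (d T)^nu exp (- lambda x)] with the tail [A exp (- lambda x)] of [U]
    gives the logarithmic drift and the constant [sigma_inf]. For [nu <> 0] no fixed shift suits all
    times, so the comparison is redone from time 0 for each [T], with the shift frozen meanwhile.
    The pure exponential tail of the given front, with [A > 0], has to be extracted from its
    equation. Far behind [x = c T] the two exponentials are large and the sandwich says nothing;
    what it does give is a moving window with [u >= 1/2], and this window feeds the invasion. *)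

Definition cont_strip (t0 T : R) (z : R -> R -> R) : Prop :=
  forall t x, t0 <= t <= T -> forall eps, 0 < eps -> exists delta, 0 < delta /\
    forall s y, t0 <= s <= T -> Rabs (s - t) < delta -> Rabs (y - x) < delta ->
      Rabs (z s y - z t x) < eps.

(** The derivatives are carried as functions, so that sums and waves come with explicit formulas. At
    [t = t0] only continuity is asked, since the datum need not be smooth. *)
Definition parab (t0 T : R) (z zt zxx : R -> R -> R) : Prop :=
  cont_strip t0 T z /\
  exists zx : R -> R -> R, forall t x, t0 < t <= T ->
    is_derive (fun s => z s x) t (zt t x) /\
    is_derive (fun y => z t y) x (zx t x) /\
    is_derive (fun y => zx t y) x (zxx t x).

(** If the infimum [- l] is not attained, [F + l] is positive on the rectangle. A gauge that is at
    once a continuity radius and at most half of [F + l] has, by compactness, a uniform lower bound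
    [d], and then [F + l >= d] everywhere, which contradicts the choice of [l]. *)
Lemma rectangle_min (t0 T B m0 : R) (F : R -> R -> R) :
  t0 <= T -> 0 <= B -> cont_strip t0 T F ->
  (forall t x, t0 <= t <= T -> m0 <= F t x) ->
  exists t x, t0 <= t <= T /\ - B <= x <= B /\
    forall s y, t0 <= s <= T -> - B <= y <= B -> F t x <= F s y.
Proof.
intros HT HB HF Hlow.
pose (E := fun r => exists t x, t0 <= t <= T /\ - B <= x <= B /\ r = - F t x).
destruct (completeness E) as [l [Hub Hlub]].
{ exists (- m0). intros r (t & x & Ht & Hx & ->). specialize (Hlow t x Ht); lra. }
{ exists (- F t0 0), t0, 0. repeat split; lra. }
destruct (classic (exists t x, t0 <= t <= T /\ - B <= x <= B /\ F t x = - l))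
  as [(t & x & Ht & Hx & Heq) | Hno].
{ exists t, x. repeat split; try lra. intros s y Hs Hy.
  assert (- F s y <= l) by (apply Hub; exists s, y; auto). lra. }
exfalso.
assert (Hpos : forall t x, t0 <= t <= T -> - B <= x <= B -> 0 < F t x + l).
{ intros t x Ht Hx.
  assert (- F t x <= l) by (apply Hub; exists t, x; auto).
  destruct (Req_dec (F t x) (- l)); [exfalso; apply Hno; exists t, x; auto | lra]. }
assert (Hd : forall t x, exists d : posreal, t0 <= t <= T -> - B <= x <= B ->
   d <= (F t x + l) / 2 /\
   forall s y, t0 <= s <= T -> Rabs (s - t) < d -> Rabs (y - x) < d ->
     (F t x + l) / 2 < F s y + l).
{ intros t x.
  destruct (classic (t0 <= t <= T /\ - B <= x <= B)) as [[Ht Hx] | Hn].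
  - specialize (Hpos t x Ht Hx).
    destruct (HF t x Ht ((F t x + l) / 2)) as (d & Hd & Hc); [lra|].
    assert (Hm : 0 < Rmin d ((F t x + l) / 2)) by (apply Rmin_pos; lra).
    exists (mkposreal _ Hm). intros _ _. simpl. split; [apply Rmin_r|].
    intros s y Hs H1 H2.
    pose proof (Rmin_l d ((F t x + l) / 2)).
    specialize (Hc s y Hs ltac:(lra) ltac:(lra)).
    apply Rabs_def2 in Hc. lra.
  - exists (mkposreal 1 Rlt_0_1). intros; exfalso; apply Hn; auto. }
pose (dl := fun t x => proj1_sig (constructive_indefinite_description _ (Hd t x))).
assert (Hdl : forall t x, t0 <= t <= T -> - B <= x <= B ->
   dl t x <= (F t x + l) / 2 /\
   forall s y, t0 <= s <= T -> Rabs (s - t) < dl t x -> Rabs (y - x) < dl t x ->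
     (F t x + l) / 2 < F s y + l).
{ intros t x. unfold dl. destruct (constructive_indefinite_description _ (Hd t x)); simpl; auto. }
destruct (compactness_value_2d t0 T (- B) B dl) as [d Hcmp].
assert (Hl : l <= l - d).
{ apply Hlub. intros r (t & x & Ht & Hx & ->).
  apply NNPP. intro Hn. apply (Hcmp t x Ht Hx).
  intros (u & v & Hu & Hv & H1 & H2 & H3). apply Hn.
  destruct (Hdl u v Hu Hv) as [H4 H5]. specialize (H5 t x Ht H1 H2). lra. }
pose proof (cond_pos d). lra.
Qed.

Lemma is_derive_Rplus (f h : R -> R) (x a b : R) :
  is_derive f x a -> is_derive h x b -> is_derive (fun y => f y + h y) x (a + b).
Proof. exact (is_derive_plus f h x a b). Qed.

Lemma is_derive_Rmult (f h : R -> R) (x a b : R) :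
  is_derive f x a -> is_derive h x b ->
  is_derive (fun y => f y * h y) x (a * h x + f x * b).
Proof.
intros Hf Hh. exact (is_derive_mult f h x a b Hf Hh Rmult_comm).
Qed.

Lemma is_derive_Rcomp (f h : R -> R) (x a b : R) :
  is_derive f (h x) a -> is_derive h x b -> is_derive (fun y => f (h y)) x (b * a).
Proof. exact (is_derive_comp f h x a b). Qed.

Lemma is_derive_eps (h : R -> R) (x l : R) : is_derive h x l ->
  forall eps, 0 < eps -> exists d, 0 < d /\
  forall y, Rabs (y - x) < d -> Rabs (h y - h x - l * (y - x)) <= eps * Rabs (y - x).
Proof.
intros [_ H] eps He.
specialize (H x (fun P HP => HP) (mkposreal _ He)).
destruct H as [d Hd]. exists d. split; [apply cond_pos|].
intros y Hy. specialize (Hd y Hy).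
replace (h y - h x - l * (y - x)) with (minus (minus (h y) (h x)) (scal (minus y x) l)); auto.
unfold minus, plus, opp, scal; simpl; unfold mult; simpl; ring.
Qed.

(** Only points to the left are compared, because a minimum over a strip may sit at the final
    time. *)
Lemma derive_left_min (h : R -> R) (a x l : R) :
  is_derive h x l -> a < x -> (forall y, a <= y <= x -> h x <= h y) -> l <= 0.
Proof.
intros Hd Ha Hm. destruct (Rle_dec l 0); auto. exfalso.
destruct (is_derive_eps h x l Hd (l / 2)) as (d & Hd0 & H); [lra|].
pose (k := Rmin (d / 2) (x - a)).
assert (0 < k) by (apply Rmin_pos; lra).
assert (k <= d / 2) by apply Rmin_l.
assert (k <= x - a) by apply Rmin_r. clearbody k.
specialize (H (x - k)). specialize (Hm (x - k)).
replace (x - k - x) with (- k) in H by ring.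
rewrite Rabs_Ropp, (Rabs_pos_eq k) in H by lra.
specialize (H ltac:(lra)). specialize (Hm ltac:(lra)).
apply Rabs_le_between in H. nra.
Qed.

(** At the minimum [h' <= 0]; if [l < 0], then [h'] is negative just to the right, and [h] falls
    below [h x] there. *)
Lemma second_derive_min (h h' : R -> R) (x r l : R) :
  0 < r -> (forall y, is_derive h y (h' y)) -> is_derive h' x l ->
  (forall y, Rabs (y - x) <= r -> h x <= h y) -> 0 <= l.
Proof.
intros Hr Hd Hd2 Hm. destruct (Rle_dec 0 l); auto. exfalso.
assert (Hle : h' x <= 0).
{ apply (derive_left_min h (x - r) x); auto; [lra|].
  intros y Hy; apply Hm. apply Rabs_le; lra. }
destruct (is_derive_eps h' x l Hd2 (- l / 2)) as (d & Hd0 & H); [lra|].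
pose (k := Rmin (d / 2) r).
assert (0 < k) by (apply Rmin_pos; lra).
assert (k <= d / 2) by apply Rmin_l.
assert (k <= r) by apply Rmin_r. clearbody k.
destruct (MVT_cor2 h h' x (x + k)) as (y & Hy & Hxy); [lra| |].
{ intros; apply is_derive_Reals; auto. }
specialize (H y). rewrite (Rabs_pos_eq (y - x)) in H by lra.
specialize (H ltac:(lra)). apply Rabs_le_between in H.
assert (h x <= h (x + k)) by (apply Hm; apply Rabs_le; lra).
replace (x + k - x) with k in Hy by ring.
assert (h' y < 0) by nra. nra.
Qed.

Lemma parab_lin (t0 T a b : R) (z zt zxx w wt wxx : R -> R -> R) :
  parab t0 T z zt zxx -> parab t0 T w wt wxx ->
  parab t0 T (fun t x => a * z t x + b * w t x)
    (fun t x => a * zt t x + b * wt t x) (fun t x => a * zxx t x + b * wxx t x).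
Proof.
intros [Cz (zx & Dz)] [Cw (wx & Dw)]. split.
- intros t x Ht eps He.
  pose proof (Rabs_pos a). pose proof (Rabs_pos b).
  assert (Hq : 0 < eps / (1 + Rabs a + Rabs b)) by (apply Rdiv_lt_0_compat; lra).
  destruct (Cz t x Ht _ Hq) as (d1 & Hd1 & H1).
  destruct (Cw t x Ht _ Hq) as (d2 & Hd2 & H2).
  exists (Rmin d1 d2). split; [apply Rmin_pos; lra|].
  intros s y Hs Hst Hyx.
  pose proof (Rmin_l d1 d2). pose proof (Rmin_r d1 d2).
  specialize (H1 s y Hs ltac:(lra) ltac:(lra)). specialize (H2 s y Hs ltac:(lra) ltac:(lra)).
  set (q := eps / (1 + Rabs a + Rabs b)) in *.
  replace eps with (q * (1 + Rabs a + Rabs b)) by (unfold q; field; lra).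
  replace (a * z s y + b * w s y - (a * z t x + b * w t x))
    with (a * (z s y - z t x) + b * (w s y - w t x)) by ring.
  eapply Rle_lt_trans; [apply Rabs_triang|]. rewrite !Rabs_mult.
  assert (Rabs a * Rabs (z s y - z t x) <= Rabs a * q) by (apply Rmult_le_compat_l; lra).
  assert (Rabs b * Rabs (w s y - w t x) <= Rabs b * q) by (apply Rmult_le_compat_l; lra).
  lra.
- exists (fun t x => a * zx t x + b * wx t x). intros t x Ht.
  destruct (Dz t x Ht) as (H1 & H2 & H3). destruct (Dw t x Ht) as (G1 & G2 & G3).
  split; [|split].
  + apply (is_derive_plus (fun s => a * z s x) (fun s => b * w s x));
    apply (is_derive_scal); assumption.
  + apply (is_derive_plus (fun y => a * z t y) (fun y => b * w t y));
    apply (is_derive_scal); assumption.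
  + apply (is_derive_plus (fun y => a * zx t y) (fun y => b * wx t y));
    apply (is_derive_scal); assumption.
Qed.

(** Common source of all comparison functions: fronts ([b = 1]), exponentials ([p = exp]), functions
    of time alone ([b = 0]) and of space alone ([c = 0]). *)
Lemma parab_wave (t0 T b c s : R) (p p1 p2 : R -> R) :
  (forall y, is_derive p y (p1 y)) -> (forall y, is_derive p1 y (p2 y)) ->
  parab t0 T (fun t x => p (b * x - c * t - s))
    (fun t x => - c * p1 (b * x - c * t - s)) (fun t x => b ^ 2 * p2 (b * x - c * t - s)).
Proof.
intros D1 D2. split.
- intros t x Ht eps He.
  assert (Hc : continuity_pt p (b * x - c * t - s)).
  { apply derivable_continuous_pt. exists (p1 (b * x - c * t - s)).
    apply is_derive_Reals, D1. }
  destruct (Hc eps He) as (d & Hd & H).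
  pose proof (Rabs_pos c). pose proof (Rabs_pos b).
  set (q := d / (1 + Rabs b + Rabs c)).
  assert (Hq : 0 < q) by (apply Rdiv_lt_0_compat; lra).
  exists q. split; auto. intros r y Hr Hrt Hyx.
  destruct (Req_dec (b * x - c * t - s) (b * y - c * r - s)) as [Heq|Hneq].
  { rewrite Heq. rewrite Rminus_diag_eq; auto. rewrite Rabs_R0; lra. }
  apply (H (b * y - c * r - s)). split; [split; [exact I | exact Hneq]|].
  simpl. unfold Rdist.
  replace (b * y - c * r - s - (b * x - c * t - s)) with (b * (y - x) + - c * (r - t)) by ring.
  eapply Rle_lt_trans; [apply Rabs_triang|]. rewrite !Rabs_mult, Rabs_Ropp.
  replace d with (q * (1 + Rabs b + Rabs c)) by (unfold q; field; lra).
  assert (Rabs b * Rabs (y - x) <= Rabs b * q) by (apply Rmult_le_compat_l; lra).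
  assert (Rabs c * Rabs (r - t) <= Rabs c * q) by (apply Rmult_le_compat_l; lra).
  lra.
- exists (fun t x => b * p1 (b * x - c * t - s)). intros t x Ht. split; [|split].
  + apply (is_derive_Rcomp p (fun r => b * x - c * r - s) t); auto.
    auto_derive; auto; ring.
  + apply (is_derive_Rcomp p (fun y => b * y - c * t - s) x); auto.
    auto_derive; auto; ring.
  + replace (b ^ 2 * p2 (b * x - c * t - s)) with (b * (b * p2 (b * x - c * t - s))) by ring.
    apply (is_derive_scal).
    apply (is_derive_Rcomp p1 (fun y => b * y - c * t - s) x); auto.
    auto_derive; auto; ring.
Qed.

(** The weight [E] removes the zeroth order term, and [1 + x^2 + 3 (t - t0)] has heat operator
    [3 - 2 = 1]. Since [z] is bounded below, the quadratic term forces a negative minimum of [W]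
    into a bounded rectangle, where the minimum conditions contradict a heat operator of at least
    [eps]. The inequality is used only where [z < 0], which lets later comparisons assume that the
    order has already failed. *)
Lemma max_principle (t0 T K M : R) (z zt zxx : R -> R -> R) :
  parab t0 T z zt zxx -> 0 <= K -> 0 <= M ->
  (forall t x, t0 <= t <= T -> - M <= z t x) ->
  (forall x, 0 <= z t0 x) ->
  (forall t x, t0 < t <= T -> z t x < 0 -> K * z t x <= zt t x - zxx t x) ->
  forall t x, t0 <= t <= T -> 0 <= z t x.
Proof.
intros [Cz (zx & Dz)] HK HM Hlow Hini Heq t1 x1 Ht1.
apply Rnot_lt_le; intro Hneg.
pose (E := fun t => exp (- K * (t - t0))).
assert (HE : forall t, t0 <= t -> 0 < E t <= 1).
{ intros t Ht. split; [apply exp_pos|]. unfold E. rewrite <- exp_0.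
  destruct (Req_dec (- K * (t - t0)) 0) as [->|]; [lra|].
  left; apply exp_increasing. nra. }
set (N := 1 + x1 ^ 2 + 3 * (t1 - t0)).
assert (HN : 0 < N) by (unfold N; nra).
(* With this value [W t1 x1] is half of [E t1 * z t1 x1], hence still negative. *)
set (eps := - (E t1 * z t1 x1) / (2 * N)).
assert (HEt := HE t1 ltac:(lra)).
assert (Heps : 0 < eps) by (apply Rdiv_lt_0_compat; nra).
pose (W := fun t x => E t * z t x + eps * (1 + x ^ 2 + 3 * (t - t0))).
assert (HW1 : W t1 x1 < 0).
{ unfold W. fold N. replace (eps * N) with (- (E t1 * z t1 x1) / 2)
    by (unfold eps; field; lra). nra. }
assert (Hz : forall t x, t0 <= t <= T -> - M <= E t * z t x).
{ intros t x Ht. specialize (Hlow t x Ht). specialize (HE t ltac:(lra)). nra. }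
(* For [|x| >= B] the quadratic term exceeds [M], so [W > 0] there and the minimum is interior in
   [x]. *)
set (B := 1 + Rabs x1 + M / eps).
assert (HMe : 0 <= M / eps) by (apply Rdiv_le_0_compat; lra).
assert (HB : 1 <= B) by (unfold B; pose proof (Rabs_pos x1); lra).
assert (HBx : Rabs x1 <= B) by (unfold B; lra).
assert (HBM : M + eps <= eps * B).
{ replace (M + eps) with (eps * (M / eps + 1)) by (field; lra).
  apply Rmult_le_compat_l; unfold B; pose proof (Rabs_pos x1); lra. }
destruct (rectangle_min t0 T B (- M) W) as (t & x & Ht & Hx & Hmin); try lra.
{ assert (CE : cont_strip t0 T (fun t _ => E t)).
  { destruct (parab_wave t0 T 0 1 (- t0) (fun r => exp (K * r))
      (fun r => K * exp (K * r)) (fun r => K * (K * exp (K * r)))) as [C _].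
    - intro y; auto_derive; auto; ring.
    - intro y; auto_derive; auto; ring.
    - intros t x Ht e He. destruct (C t x Ht e He) as (d & Hd & H).
      exists d; split; auto. intros s y Hs A1 A2. specialize (H s y Hs A1 A2).
      unfold E. replace (- K * (s - t0)) with (K * (0 * y - 1 * s - - t0)) by ring.
      replace (- K * (t - t0)) with (K * (0 * x - 1 * t - - t0)) by ring. exact H. }
  intros t x Ht e He.
  assert (P := parab_wave t0 T 1 0 0 (fun y => y ^ 2) (fun y => 2 * y) (fun y => 2)).
  destruct P as [Cx _].
  { intro y; auto_derive; auto; ring. }
  { intro y; auto_derive; auto; ring. }
  (* [Q] adds up the coefficients of [q] in the expansion of the increment of [W] below. *)
  set (Q := E t + Rabs (z t x) + 1 + eps + 3 * eps).
  assert (HQ : 0 < Q) by (unfold Q; pose proof (Rabs_pos (z t x)); pose proof (HE t ltac:(lra)); lra).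
  set (q := Rmin 1 (e / Q)).
  assert (HeQ : 0 < e / Q) by (apply Rdiv_lt_0_compat; lra).
  assert (Hq : 0 < q) by (apply Rmin_pos; lra).
  assert (Hq1 : q <= 1) by apply Rmin_l.
  assert (Hq2 : q * Q <= e).
  { replace e with (e / Q * Q) by (field; lra). apply Rmult_le_compat_r; [lra|apply Rmin_r]. }
  destruct (Cz t x Ht q Hq) as (d1 & Hd1 & H1).
  destruct (CE t x Ht q Hq) as (d2 & Hd2 & H2).
  destruct (Cx t x Ht q Hq) as (d3 & Hd3 & H3).
  exists (Rmin (Rmin d1 d2) (Rmin d3 q)).
  split; [apply Rmin_pos; apply Rmin_pos; assumption|].
  intros s y Hs Hst Hyx.
  pose proof (Rmin_l (Rmin d1 d2) (Rmin d3 q)). pose proof (Rmin_r (Rmin d1 d2) (Rmin d3 q)).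
  pose proof (Rmin_l d1 d2). pose proof (Rmin_r d1 d2).
  pose proof (Rmin_l d3 q). pose proof (Rmin_r d3 q).
  specialize (H1 s y Hs ltac:(lra) ltac:(lra)). specialize (H2 s y Hs ltac:(lra) ltac:(lra)).
  specialize (H3 s y Hs ltac:(lra) ltac:(lra)). simpl in H3.
  assert (Hstq : Rabs (s - t) < q) by lra.
  unfold W.
  replace (E s * z s y + eps * (1 + y ^ 2 + 3 * (s - t0)) -
     (E t * z t x + eps * (1 + x ^ 2 + 3 * (t - t0))))
  with (E t * (z s y - z t x) + ((z t x) * (E s - E t) + ((E s - E t) * (z s y - z t x) +
     (eps * ((1*y-0*s-0) * ((1*y-0*s-0) * 1) - (1*x-0*t-0) * ((1*x-0*t-0) * 1)) + 3 * eps * (s - t))))) by ring.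
  eapply Rle_lt_trans; [apply Rabs_triang|].
  eapply Rle_lt_trans; [apply Rplus_le_compat_l, Rabs_triang|].
  eapply Rle_lt_trans; [apply Rplus_le_compat_l, Rplus_le_compat_l, Rabs_triang|].
  eapply Rle_lt_trans; [apply Rplus_le_compat_l, Rplus_le_compat_l, Rplus_le_compat_l, Rabs_triang|].
  rewrite !Rabs_mult, (Rabs_pos_eq (E t)), (Rabs_pos_eq eps), (Rabs_pos_eq 3)
    by (try apply Rlt_le, HE; lra).
  eapply Rlt_le_trans; [|exact Hq2]. unfold Q.
  pose proof (HE t ltac:(lra)).
  rewrite <- Rabs_mult.
  assert (Rabs (z t x) * Rabs (E s - E t) <= Rabs (z t x) * q)
    by (apply Rmult_le_compat_l; [apply Rabs_pos|lra]).
  assert (E t * Rabs (z s y - z t x) < E t * q) by (apply Rmult_lt_compat_l; lra).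
  assert (Rabs (E s - E t) * Rabs (z s y - z t x) <= 1 * q)
    by (apply Rmult_le_compat; try apply Rabs_pos; lra).
  rewrite Rabs_mult in *.
  assert (Rabs (E s - E t) * Rabs (z s y - z t x) <= q) by lra.
  assert (eps * Rabs ((1*y-0*s-0) * ((1*y-0*s-0) * 1) - (1*x-0*t-0) * ((1*x-0*t-0) * 1)) <= eps * q)
    by (apply Rmult_le_compat_l; lra).
  assert (3 * eps * Rabs (s - t) <= 3 * eps * q) by (apply Rmult_le_compat_l; lra).
  lra. }
{ intros t x Ht. specialize (Hz t x Ht). unfold W.
  assert (0 <= eps * (1 + x ^ 2 + 3 * (t - t0))) by (apply Rmult_le_pos; nra). lra. }
assert (HW : W t x < 0).
{ eapply Rle_lt_trans; [apply (Hmin t1 x1); auto|exact HW1].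
  apply Rabs_le_between; exact HBx. }
assert (Hzn : z t x < 0).
{ unfold W in HW. assert (0 <= eps * (1 + x ^ 2 + 3 * (t - t0))) by (apply Rmult_le_pos; nra).
  pose proof (HE t ltac:(lra)). nra. }
assert (Htt : t0 < t).
{ destruct (Req_dec t t0) as [->|]; [specialize (Hini x); lra | lra]. }
assert (HxB : x ^ 2 < B ^ 2).
{ apply Rnot_le_lt; intro Hbad. specialize (Hz t x Ht). unfold W in HW.
  assert (B <= B ^ 2) by nra.
  assert (eps * B <= eps * (1 + x ^ 2 + 3 * (t - t0))) by (apply Rmult_le_compat_l; nra). lra. }
assert (HxB' : - B < x < B) by nra.
destruct (Dz t x (conj Htt (proj2 Ht))) as (D1 & D2 & D3).
assert (Ht' : E t * zt t x - K * E t * z t x + 3 * eps <= 0).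
{ apply (derive_left_min (fun s => W s x) t0 t); auto.
  - unfold W.
    replace (E t * zt t x - K * E t * z t x + 3 * eps)
      with ((- K * E t) * z t x + E t * zt t x + 3 * eps) by ring.
    apply (is_derive_Rplus (fun s => E s * z s x)).
    + apply (is_derive_Rmult E (fun s => z s x)); auto.
      unfold E; auto_derive; auto; unfold Rminus; ring.
    + auto_derive; auto; ring.
  - intros s Hs. apply Hmin; lra. }
assert (Hx' : 0 <= E t * zxx t x + 2 * eps).
{ apply (second_derive_min (fun y => W t y) (fun y => E t * zx t y + eps * (2 * y)) x
    (Rmin (B - x) (x + B))).
  - apply Rmin_pos; lra.
  - intro y. destruct (Dz t y (conj Htt (proj2 Ht))) as (_ & D2' & _). unfold W.
    apply (is_derive_Rplus (fun y => E t * z t y)).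
    + apply (is_derive_scal); auto.
    + auto_derive; auto; ring.
  - apply (is_derive_Rplus (fun y => E t * zx t y)).
    + apply (is_derive_scal); auto.
    + auto_derive; auto; ring.
  - intros y Hy. apply Hmin; [lra|].
    pose proof (Rmin_l (B - x) (x + B)). pose proof (Rmin_r (B - x) (x + B)).
    apply Rabs_le_between in Hy. lra. }
specialize (Heq t x (conj Htt (proj2 Ht)) Hzn).
pose proof (HE t ltac:(lra)). nra.
Qed.

(** * KPP nonlinearity and decay of the front *)

(** The bounds extend past 1 because supersolutions exceed 1. [kpp_neg] records the linear
    extension, which keeps solutions nonnegative; [kpp_ratio] is the monotonicity of [f(s)/s]
    cleared of denominators; [kpp_quad] is the trace of the second derivative and makes the front
    tail purely exponential. *)
Record kpp (f : R -> R) (mu : R) : Prop := {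
  kpp_mu : 0 < mu;
  kpp_0 : f 0 = 0;
  kpp_1 : f 1 = 0;
  kpp_neg : forall s, s < 0 -> f s = mu * s;
  kpp_pos : forall s, 0 < s < 1 -> 0 < f s;
  kpp_le : forall s, 0 <= s -> f s <= mu * s;
  kpp_ratio : forall s t, 0 < s -> s <= t -> f t * s <= f s * t;
  kpp_quad : exists K, 0 < K /\ forall s, 0 <= s <= 1 -> mu * s - f s <= K * s ^ 2
}.

(** Past 1 everything follows from [g'(1) <= 0]. The quadratic bound is Taylor's formula, by two
    mean values and the minimum of [g''] on [[0,1]]. *)
Lemma lin_ext_kpp (g : R -> R) :
  C2_on_R g -> g 0 = 0 -> g 1 = 0 ->
  (forall s, 0 < s < 1 -> 0 < g s <= Derive g 0 * s) ->
  (forall s t, 0 < s -> s <= t -> t <= 1 -> g t / t <= g s / s) ->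
  kpp (lin_ext g) (Derive g 0).
Proof.
intros (D1 & D2 & C2) g0 g1 Hb Hr.
assert (Hmu : 0 < Derive g 0) by (specialize (Hb (1 / 2) ltac:(lra)); lra).
assert (H1 : Derive g 1 <= 0).
{ apply (derive_left_min g (1 / 2) 1); [apply Derive_correct, D1|lra|].
  intros y Hy. rewrite g1. destruct (Req_dec y 1) as [->|]; [lra|].
  specialize (Hb y ltac:(lra)); lra. }
assert (E : forall s, 0 <= s <= 1 -> lin_ext g s = g s).
{ intros s Hs. unfold lin_ext. destruct (Rlt_dec s 0); [lra|]. destruct (Rlt_dec 1 s); lra. }
assert (Eg : forall s, 1 < s -> lin_ext g s = Derive g 1 * (s - 1)).
{ intros s Hs. unfold lin_ext. destruct (Rlt_dec s 0); [lra|]. destruct (Rlt_dec 1 s); lra. }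
assert (Hn : forall s, 0 <= s <= 1 -> 0 <= g s).
{ intros s Hs. destruct (Req_dec s 0) as [->|]; [lra|]. destruct (Req_dec s 1) as [->|]; [lra|].
  specialize (Hb s ltac:(lra)); lra. }
split; auto.
- rewrite E; lra.
- rewrite E; lra.
- intros s Hs. unfold lin_ext. destruct (Rlt_dec s 0); lra.
- intros s Hs. rewrite E by lra. apply Hb; lra.
- intros s Hs. destruct (Rle_dec s 1).
  + rewrite E by lra. destruct (Req_dec s 0) as [->|]; [lra|].
    destruct (Req_dec s 1) as [->|]; [lra|]. apply Hb; lra.
  + rewrite Eg by lra. nra.
- intros s t Hs Hst. destruct (Rle_dec t 1).
  + rewrite !E by lra. specialize (Hr s t Hs Hst ltac:(lra)).
    apply (Rmult_le_compat_r (t * s)) in Hr; [|nra].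
    replace (g t / t * (t * s)) with (g t * s) in Hr by (field; lra).
    replace (g s / s * (t * s)) with (g s * t) in Hr by (field; lra). exact Hr.
  + rewrite (Eg t) by lra. destruct (Rle_dec s 1).
    * rewrite E by lra. specialize (Hn s ltac:(lra)).
      assert (0 <= g s * t) by (apply Rmult_le_pos; lra).
      assert (0 <= (t - 1) * s) by (apply Rmult_le_pos; lra). nra.
    * rewrite Eg by lra. nra.
- destruct (continuity_ab_min (Derive (Derive g)) 0 1) as (m & Hm & _); [lra| |].
  { intros s _. apply continuity_pt_filterlim. apply C2. }
  set (K := Derive (Derive g) m) in *.
  exists (Rabs K + 1). split; [pose proof (Rabs_pos K); lra|]. intros s Hs. rewrite E by auto.
  destruct (Req_dec s 0) as [->|Hs0]; [rewrite g0; nra|].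
  destruct (MVT_cor2 g (Derive g) 0 s) as (x & Hx & Hx'); [lra| |].
  { intros; apply is_derive_Reals, Derive_correct, D1. }
  destruct (MVT_cor2 (Derive g) (Derive (Derive g)) 0 x) as (y & Hy & Hy'); [lra| |].
  { intros; apply is_derive_Reals, Derive_correct, D2. }
  specialize (Hm y ltac:(lra)).
  pose proof (Rle_abs (- K)). rewrite Rabs_Ropp in *.
  assert (- (Rabs K + 1) * x <= Derive g x - Derive g 0).
  { rewrite Hy. rewrite Rminus_0_r. apply Rmult_le_compat_r; lra. }
  assert (- (Rabs K + 1) * s <= - (Rabs K + 1) * x) by (pose proof (Rabs_pos K); nra).
  nra.
Qed.

(** For [u > 0], [f v <= (f u / u) v], so the increment is at most [(f u / u) (v - u)], and
    [f u / u <= mu]. *)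
Lemma kpp_lip (f : R -> R) (mu u v : R) :
  kpp f mu -> 0 <= u -> u <= v -> f v - f u <= mu * (v - u).
Proof.
intros Hf Hu Huv. destruct (Req_dec u 0) as [->|].
- rewrite (kpp_0 _ _ Hf). pose proof (kpp_le _ _ Hf v ltac:(lra)). lra.
- pose proof (kpp_ratio _ _ Hf u v ltac:(lra) Huv).
  pose proof (kpp_le _ _ Hf u Hu). pose proof (kpp_mu _ _ Hf).
  assert ((f v - f u) * u <= (mu * (v - u)) * u) by nra.
  apply (Rmult_le_reg_r u); lra.
Qed.

Lemma kpp_half (f : R -> R) (mu : R) : kpp f mu ->
  exists s0, 0 < s0 < 1 /\ forall s, 0 <= s <= s0 -> mu / 2 * s <= f s.
Proof.
intros Hf. destruct (kpp_quad _ _ Hf) as (K & HK & H). pose proof (kpp_mu _ _ Hf).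
assert (0 < mu / (2 * K)) by (apply Rdiv_lt_0_compat; lra).
exists (Rmin (1 / 2) (mu / (2 * K))).
pose proof (Rmin_l (1 / 2) (mu / (2 * K))). pose proof (Rmin_r (1 / 2) (mu / (2 * K))).
split; [split; [apply Rmin_pos; lra|lra]|].
intros s Hs. specialize (H s ltac:(lra)).
assert (K * s <= mu / 2).
{ replace (mu / 2) with (K * (mu / (2 * K))) by (field; lra).
  apply Rmult_le_compat_l; lra. }
nra.
Qed.

Lemma derive_nonneg_le (h h' : R -> R) (a b : R) :
  a <= b -> (forall x, a <= x <= b -> is_derive h x (h' x)) ->
  (forall x, a <= x <= b -> 0 <= h' x) -> h a <= h b.
Proof.
intros Hab Hd Hp. destruct (Req_dec a b) as [->|]; [lra|].
destruct (MVT_cor2 h h' a b) as (x & Hx & Hx'); [lra| |].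
{ intros; apply is_derive_Reals; auto. }
specialize (Hp x ltac:(lra)). nra.
Qed.

Lemma exp_decay (d Q eps : R) : 0 < d -> 0 < eps ->
  exists X, forall x, X <= x -> Q * exp (- d * x) <= eps.
Proof.
intros Hd He. exists (Rabs Q / (eps * d)). intros x Hx.
replace eps with ((eps * exp (d * x)) * exp (- d * x)).
2:{ rewrite Rmult_assoc, <- exp_plus. replace (d * x + - d * x) with 0 by ring.
    rewrite exp_0; ring. }
apply Rmult_le_compat_r; [left; apply exp_pos|].
assert (0 < eps * d) by (apply Rmult_lt_0_compat; lra).
pose proof (Rle_abs Q).
assert (Rabs Q <= eps * (d * x)).
{ replace (Rabs Q) with (eps * d * (Rabs Q / (eps * d))) by (field; lra).
  rewrite <- Rmult_assoc. apply Rmult_le_compat_l; lra. }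
assert (0 <= d * x).
{ apply Rmult_le_pos; [lra|]. eapply Rle_trans; [|exact Hx].
  apply Rdiv_le_0_compat; [apply Rabs_pos|lra]. }
assert (1 + d * x <= exp (d * x)).
{ destruct (Req_dec (d * x) 0) as [->|]; [rewrite exp_0; lra|]. left; apply exp_ineq1; lra. }
nra.
Qed.

(** The linearised front equation has decay rates [lam < l2]. The factor [V + l2 * U] kills the fast
    mode, so [p] is nondecreasing and measures the slow one: on [exp (- lam x)] it equals [d]. If
    [p] increases to a finite [P], integrating [(exp (l2 x) U)' = exp (d x) p] gives the limit
    [P / d]. Finiteness of [P] is the hard point. *)
Lemma front_asymptotics (f U : R -> R) (mu lam : R) :
  kpp f mu -> 0 < lam -> lam * lam < mu ->
  is_front f (lam + mu / lam) U ->
  exists A, 0 < A /\ forall eps, 0 < eps -> exists X, forall x, X <= x ->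
    Rabs (exp (lam * x) * U x - A) <= eps.
Proof.
intros Hf Hlam Hlm (HU & Hdec & HD1 & HD2 & Hode & Hm & Hp).
pose proof (kpp_mu _ _ Hf) as Hmu.
set (l2 := mu / lam) in *. set (c := lam + l2) in *.
assert (El2 : lam * l2 = mu) by (unfold l2; field; lra).
assert (Hl2 : lam < l2) by nra.
set (d := l2 - lam). assert (Hd : 0 < d) by (unfold d; lra).
set (V := Derive U).
assert (D1 : forall x, is_derive U x (V x)) by (intro; apply Derive_correct, HD1).
assert (D2 : forall x, is_derive V x (- (c * V x + f (U x)))).
{ intro x. replace (- (c * V x + f (U x))) with (Derive V x).
  - apply Derive_correct, HD2.
  - specialize (Hode x). unfold V in *. lra. }
assert (DE : forall k x, is_derive (fun y => exp (k * y)) x (k * exp (k * x))).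
{ intros k x. auto_derive; auto; ring. }
assert (HfU : forall x, 0 < f (U x)) by (intro; apply (kpp_pos _ _ Hf), HU).
pose (p := fun x => exp (lam * x) * (V x + l2 * U x)).
assert (Dp : forall x, is_derive p x (exp (lam * x) * (mu * U x - f (U x)))).
{ intro x. unfold p.
  replace (exp (lam * x) * (mu * U x - f (U x))) with
    (lam * exp (lam * x) * (V x + l2 * U x) + exp (lam * x) * (- (c * V x + f (U x)) + l2 * V x))
    by (unfold c; rewrite <- El2; ring).
  apply (is_derive_Rmult (fun y => exp (lam * y)) (fun y => V y + l2 * U y)); auto.
  apply is_derive_Rplus; auto. apply is_derive_scal; auto. }
assert (Hp_mono : forall a b, a <= b -> p a <= p b).
{ intros a b Hab. apply (derive_nonneg_le p (fun x => exp (lam * x) * (mu * U x - f (U x)))); auto.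
  intros x _. apply Rmult_le_pos; [left; apply exp_pos|].
  pose proof (kpp_le _ _ Hf (U x)). specialize (HU x). lra. }
(* Near minus infinity [U] is close to 1 and a mean value makes its slope small, so
   [V + l2 * U > 0]. With monotonicity this rules out decay at the fast rate and gives a positive
   limit. *)
assert (Hx0 : exists x0, 0 < p x0).
{ set (dl := Rmin (1 / 2) (l2 / 8)).
  assert (0 < dl) by (apply Rmin_pos; lra).
  assert (dl <= 1 / 2) by apply Rmin_l.
  assert (dl <= l2 / 8) by apply Rmin_r.
  apply is_lim_spec in Hm. destruct (Hm (mkposreal dl H)) as [X HX]. simpl in HX.
  destruct (MVT_cor2 U V (X - 2) (X - 1)) as (y & Hy & Hy'); [lra| |].
  { intros; apply is_derive_Reals; auto. }
  exists y. unfold p. apply Rmult_lt_0_compat; [apply exp_pos|].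
  pose proof (HX (X - 1) ltac:(lra)) as Q1. pose proof (HX y ltac:(lra)) as Q2.
  apply Rabs_def2 in Q1. apply Rabs_def2 in Q2.
  pose proof (HU (X - 2)). clearbody dl. clearbody d.
  assert (V y > - dl) by nra. assert (l2 * U y > l2 * (1 / 2)) by nra. lra. }
destruct Hx0 as [x0 Hx0].
pose (G := fun x => V x + c * U x).
assert (Hc : 0 < c) by (unfold c; lra).
assert (DG : forall x, is_derive G x (- f (U x))).
{ intro x. unfold G. replace (- f (U x)) with (- (c * V x + f (U x)) + c * V x) by ring.
  apply is_derive_Rplus; auto. apply is_derive_scal; auto. }
(* [G] is nonincreasing and [V <= G]. If [G y < 0], then [U] would fall by at least 2 over the
   length [n], impossible for values in [(0,1)]. *)
assert (HG : forall y, 0 <= G y).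
{ intro y. apply Rnot_lt_le; intro Hneg.
  set (n := - 2 / G y).
  assert (Hn : 0 < n). { unfold n. replace (-2 / G y) with (2 / (- G y)) by (field; lra).
    apply Rdiv_lt_0_compat; lra. }
  destruct (MVT_cor2 U V y (y + n)) as (x & Hx & Hx'); [lra| |].
  { intros; apply is_derive_Reals; auto. }
  assert (- G y <= - G x).
  { apply (derive_nonneg_le (fun z => - G z) (fun z => - - f (U z))); [lra| |].
    - intros z _. apply (is_derive_opp G z _ (DG z)).
    - intros z _. specialize (HfU z). lra. }
  assert (V x <= G y). { unfold G in *. pose proof (HU x). nra. }
  assert (G y * n = -2) by (unfold n; field; lra).
  pose proof (HU y). pose proof (HU (y + n)).
  replace (y + n - y) with n in Hx by ring. nra. }
pose (E := fun x => exp (lam * x) * U x).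
assert (HE : forall x, 0 < E x).
{ intro x. apply Rmult_lt_0_compat; [apply exp_pos|apply HU]. }
pose (Y := fun x => exp (l2 * x) * U x).
assert (EY : forall x, Y x = exp (d * x) * E x).
{ intro x. unfold Y, E. rewrite <- Rmult_assoc, <- exp_plus. f_equal. f_equal. unfold d; ring. }
assert (DY : forall x, is_derive Y x (exp (d * x) * p x)).
{ intro x. unfold Y, p.
  replace (exp (d * x) * (exp (lam * x) * (V x + l2 * U x))) with
    (l2 * exp (l2 * x) * U x + exp (l2 * x) * V x).
  - apply (is_derive_Rmult (fun y => exp (l2 * y)) U); auto.
  - rewrite <- (Rmult_assoc (exp (d * x))), <- exp_plus.
    replace (d * x + lam * x) with (l2 * x) by (unfold d; ring). ring. }
assert (HYup : forall a b P, a <= b -> (forall x, a <= x <= b -> p x <= P) ->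
   Y b - Y a <= P / d * (exp (d * b) - exp (d * a))).
{ intros a b P Hab HP.
  assert (P / d * exp (d * a) + (-1) * Y a <= P / d * exp (d * b) + (-1) * Y b).
  { apply (derive_nonneg_le (fun x => P / d * exp (d * x) + (-1) * Y x)
     (fun x => P / d * (d * exp (d * x)) + (-1) * (exp (d * x) * p x))); auto.
    - intros x _. apply is_derive_Rplus; apply is_derive_scal; auto.
    - intros x Hx. replace (P / d * (d * exp (d * x)) + (-1) * (exp (d * x) * p x))
        with (exp (d * x) * (P - p x)) by (field; lra).
      apply Rmult_le_pos; [left; apply exp_pos|]. specialize (HP x Hx); lra. }
  lra. }
assert (HYlo : forall a b P, a <= b -> (forall x, a <= x <= b -> P <= p x) ->
   P / d * (exp (d * b) - exp (d * a)) <= Y b - Y a).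
{ intros a b P Hab HP.
  assert (- (P / d) * exp (d * a) + 1 * Y a <= - (P / d) * exp (d * b) + 1 * Y b).
  { apply (derive_nonneg_le (fun x => - (P / d) * exp (d * x) + 1 * Y x)
     (fun x => - (P / d) * (d * exp (d * x)) + 1 * (exp (d * x) * p x))); auto.
    - intros x _. apply is_derive_Rplus; apply is_derive_scal; auto.
    - intros x Hx. replace (- (P / d) * (d * exp (d * x)) + 1 * (exp (d * x) * p x))
        with (exp (d * x) * (p x - P)) by (field; lra).
      apply Rmult_le_pos; [left; apply exp_pos|]. specialize (HP x Hx); lra. }
  lra. }
assert (Hexp : forall x, exp (- d * x) * exp (d * x) = 1).
{ intro x. rewrite <- exp_plus. replace (- d * x + d * x) with 0 by ring. apply exp_0. }
assert (EE : forall x, E x = exp (- d * x) * Y x).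
{ intro x. rewrite EY, <- Rmult_assoc, Hexp. ring. }
(* Integrating [Y'] with [p] bounded by its last value gives [E x <= p x / d + E x0]; the last term
   is at most [E x0 / p x0] times [p x]. *)
set (Cp := 1 / d + E x0 / p x0).
assert (HCp : forall x, x0 <= x -> E x <= Cp * p x).
{ intros x Hx. assert (Hpx := Hp_mono x0 x Hx).
  assert (Hy := HYup x0 x (p x) Hx ltac:(intros; apply Hp_mono; lra)).
  assert (E x <= p x / d + E x0).
  { rewrite EE. rewrite (EY x0) in Hy.
    assert (Y x <= exp (d * x) * (p x / d + E x0)).
    { assert (exp (d * x0) <= exp (d * x)).
      { destruct (Req_dec x0 x) as [->|]; [lra|]. left; apply exp_increasing.
        apply Rmult_lt_compat_l; lra. }
      assert (0 <= p x / d) by (apply Rdiv_le_0_compat; lra).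
      pose proof (exp_pos (d * x0)). specialize (HE x0). nra. }
    replace (p x / d + E x0) with (exp (- d * x) * (exp (d * x) * (p x / d + E x0)))
      by (rewrite <- Rmult_assoc, Hexp; ring).
    apply Rmult_le_compat_l; [left; apply exp_pos|auto]. }
  eapply Rle_trans; [exact H|]. unfold Cp.
  assert (E x0 <= E x0 / p x0 * p x).
  { replace (E x0) with (E x0 / p x0 * p x0) at 1 by (field; lra).
    apply Rmult_le_compat_l; [|lra]. apply Rdiv_le_0_compat; [left; apply HE|lra]. }
  replace (p x / d) with (1 / d * p x) by (field; lra). lra. }
assert (HCp0 : 0 < Cp).
{ unfold Cp. assert (0 < 1 / d) by (apply Rdiv_lt_0_compat; lra).
  assert (0 < E x0 / p x0) by (apply Rdiv_lt_0_compat; auto). lra. }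
destruct (kpp_quad _ _ Hf) as (K & HK & Hquad).
destruct (kpp_half _ _ Hf) as (s0 & Hs0 & Hhalf).
assert (Hx1 : exists x1, x0 <= x1 /\ forall x, x1 <= x -> U x <= s0).
{ apply is_lim_spec in Hp. destruct (Hp (mkposreal s0 (proj1 Hs0))) as [X HX]. simpl in HX.
  exists (Rmax x0 (X + 1)). split; [apply Rmax_l|]. intros x Hx.
  pose proof (Rmax_r x0 (X + 1)). specialize (HX x ltac:(lra)). apply Rabs_def2 in HX. lra. }
destruct Hx1 as (x1 & Hx01 & HUs).
(* Chosen so that [kap * (mu / 2) = K * Cp]: the quadratic bound gives [p' <= K U E <= K Cp U p],
   and [U <= s0] bounds this by [kap f(U) p]. *)
set (kap := 2 * K * Cp / mu).
assert (Hkap : 0 < kap) by (unfold kap; apply Rdiv_lt_0_compat; nra).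
(* The integrability of [f (U)], encoded in [G' = - f (U)] with [G >= 0],
   controls the logarithmic growth of [p]. *)
assert (HpH : forall x, x1 <= x -> p x <= p x1 * exp (kap * G x1)).
{ intros x Hx.
  assert (HH : - (p x1 * exp (kap * G x1)) <= - (p x * exp (kap * G x))).
  { apply (derive_nonneg_le (fun x => - (p x * exp (kap * G x))) (fun x =>
      - (exp (lam * x) * (mu * U x - f (U x)) * exp (kap * G x)
        + p x * (kap * - f (U x) * exp (kap * G x))))); auto.
    - intros y _. apply (is_derive_opp (fun y => p y * exp (kap * G y))).
      apply (is_derive_Rmult p (fun y => exp (kap * G y))); auto.
      apply (is_derive_Rcomp exp (fun y => kap * G y)); [apply is_derive_exp|].
      apply is_derive_scal; auto.
    - intros y Hy.
      replace (- (exp (lam * y) * (mu * U y - f (U y)) * exp (kap * G y) +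
        p y * (kap * - f (U y) * exp (kap * G y)))) with
        (exp (kap * G y) * (kap * f (U y) * p y - exp (lam * y) * (mu * U y - f (U y)))) by ring.
      apply Rmult_le_pos; [left; apply exp_pos|].
      pose proof (HU y) as Huy. pose proof (HUs y ltac:(lra)).
      specialize (Hquad (U y) ltac:(lra)). specialize (Hhalf (U y) ltac:(lra)).
      specialize (HCp y ltac:(lra)).
      assert (Hpy : 0 < p y) by (pose proof (Hp_mono x0 y ltac:(lra)); lra).
      assert (A1 : exp (lam * y) * (mu * U y - f (U y)) <= K * U y * E y).
      { unfold E. replace (K * U y * (exp (lam * y) * U y)) with
          (exp (lam * y) * (K * U y ^ 2)) by ring.
        apply Rmult_le_compat_l; [left; apply exp_pos|lra]. }
      assert (A2 : K * U y * E y <= K * U y * (Cp * p y)) by (apply Rmult_le_compat_l; nra).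
      assert (A3 : kap * (mu / 2 * U y) <= kap * f (U y)) by (apply Rmult_le_compat_l; lra).
      assert (A4 : kap * (mu / 2 * U y) = K * U y * Cp) by (unfold kap; field; lra).
      assert (A5 : K * U y * Cp * p y <= kap * f (U y) * p y) by (apply Rmult_le_compat_r; lra).
      lra. }
  assert (1 <= exp (kap * G x)).
  { rewrite <- exp_0. assert (H0 : 0 <= kap * G x) by (apply Rmult_le_pos; [lra|apply HG]).
    destruct (Req_dec (kap * G x) 0) as [->|]; [lra|]. left; apply exp_increasing; lra. }
  assert (Hpy : 0 < p x) by (pose proof (Hp_mono x0 x ltac:(lra)); lra).
  nra. }
destruct (completeness (fun r => exists x, x1 <= x /\ r = p x)) as [P [HPub HPlub]].
{ exists (p x1 * exp (kap * G x1)). intros r (x & Hx & ->). auto. }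
{ exists (p x1), x1. split; [lra|auto]. }
assert (HPp : forall x, p x <= P).
{ intro x. eapply Rle_trans; [apply (Hp_mono x (Rmax x x1)), Rmax_l|].
  apply HPub. exists (Rmax x x1). split; [apply Rmax_r|auto]. }
assert (HP : 0 < P) by (specialize (HPp x0); lra).
exists (P / d). split; [apply Rdiv_lt_0_compat; lra|].
intros eps Heps.
(* Beyond [x2] the values of [p] lie within [eps * d / 2] of [P], which costs [eps / 2] in [E]; what
   is left over from [x2] decays like [exp (- d * x)]. *)
assert (Hx2 : exists x2, P - eps * d / 2 < p x2).
{ apply NNPP. intro Hno.
  assert (P <= P - eps * d / 2).
  { apply HPlub. intros r (x & Hx & ->). apply Rnot_lt_le. intro. apply Hno; exists x; auto. }
  nra. }
destruct Hx2 as [x2 Hx2].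
destruct (exp_decay d (Y x2 + P / d * exp (d * x2)) (eps / 2)) as [X HX]; [lra|lra|].
exists (Rmax X x2). intros x Hx.
pose proof (Rmax_l X x2). pose proof (Rmax_r X x2).
specialize (HX x ltac:(lra)).
assert (U1 := HYup x2 x P ltac:(lra) ltac:(intros; apply HPp)).
assert (U2 := HYlo x2 x (P - eps * d / 2) ltac:(lra)
  ltac:(intros y Hy; pose proof (Hp_mono x2 y (proj1 Hy)); lra)).
fold (E x). rewrite EE.
pose proof (exp_pos (- d * x)) as He. pose proof (exp_pos (d * x2)) as He2. pose proof (HE x2).
assert (HYx : 0 < Y x2) by (rewrite EY; apply Rmult_lt_0_compat; auto).
assert (HPd : 0 < P / d) by (apply Rdiv_lt_0_compat; lra).
apply Rabs_le. split.
- apply (Rmult_le_compat_l (exp (- d * x))) in U2; [|lra].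
  replace (exp (- d * x) * ((P - eps * d / 2) / d * (exp (d * x) - exp (d * x2)))) with
   ((P / d - eps / 2) * (exp (- d * x) * exp (d * x)) - (P / d - eps / 2) * exp (- d * x) * exp (d * x2))
   in U2 by (field; lra).
  rewrite Hexp in U2.
  assert (0 <= exp (- d * x) * exp (d * x2) * (eps / 2)) by (repeat apply Rmult_le_pos; lra).
  assert (0 <= exp (- d * x) * Y x2) by (apply Rmult_le_pos; lra).
  nra.
- apply (Rmult_le_compat_l (exp (- d * x))) in U1; [|lra].
  replace (exp (- d * x) * (P / d * (exp (d * x) - exp (d * x2)))) with
   (P / d * (exp (- d * x) * exp (d * x)) - P / d * exp (- d * x) * exp (d * x2))
   in U1 by ring.
  rewrite Hexp in U1.
  assert (0 <= P / d * (exp (- d * x) * exp (d * x2))) by (apply Rmult_le_pos; [lra|apply Rmult_le_pos; lra]).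
  nra.
Qed.

(** * Comparison with fronts perturbed by exponentials *)

Definition bounded_solution (f : R -> R) (M : R) (u ut uxx : R -> R -> R) : Prop :=
  (forall t0 T, 0 <= t0 -> parab t0 T u ut uxx) /\
  (forall t x, 0 < t -> ut t x = uxx t x + f (u t x)) /\
  0 <= M /\ (forall t x, 0 <= t -> Rabs (u t x) <= M).

Lemma classical_bounded_solution (f u0 : R -> R) (u : R -> R -> R) :
  classical_solution f u0 u -> exists M ut uxx, bounded_solution f M u ut uxx.
Proof.
intros (Hc & Hd & _ & He & _ & M & HM).
exists M, (fun t x => Derive (fun s => u s x) t),
  (fun t x => Derive (fun y => Derive (fun z => u t z) y) x).
split; [|split; [exact He|split; [|exact HM]]].
- intros t0 T Ht0. split.
  + intros t x Ht eps Heps. destruct (Hc t x ltac:(lra) eps Heps) as (dl & Hdl & H).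
    exists dl; split; auto. intros; apply H; auto; lra.
  + exists (fun t x => Derive (fun z => u t z) x). intros t x Ht.
    destruct (Hd t x ltac:(lra)) as (H1 & H2 & H3).
    split; [|split]; apply Derive_correct; auto.
- specialize (HM 0 0 ltac:(lra)). pose proof (Rabs_pos (u 0 0)). lra.
Qed.

Lemma parab_const (t0 T k : R) :
  parab t0 T (fun _ _ => k) (fun _ _ => 0) (fun _ _ => 0).
Proof.
split.
- intros t x _ eps He. exists 1. split; [lra|]. intros.
  rewrite Rminus_diag_eq, Rabs_R0; auto.
- exists (fun _ _ => 0). intros t x _. split; [|split]; auto_derive; auto.
Qed.

(** Where the order fails, [u > v > 0], so [kpp_lip] from [v] up to [u] gives the inequality
    required of [v - u]. *)
Lemma supersolution_ge (f : R -> R) (mu M t0 T : R) (u ut uxx v vt vxx : R -> R -> R) :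
  kpp f mu -> bounded_solution f M u ut uxx -> 0 <= t0 ->
  parab t0 T v vt vxx ->
  (forall t x, t0 <= t <= T -> 0 < v t x) ->
  (forall t x, t0 < t <= T -> f (v t x) <= vt t x - vxx t x) ->
  (forall x, u t0 x <= v t0 x) ->
  forall t x, t0 <= t <= T -> u t x <= v t x.
Proof.
intros Hf (Hu & Heq & HM & Hb) Ht0 Hv Hpos Hsup Hini t x Ht.
assert (0 <= 1 * v t x + (-1) * u t x); [|lra].
apply (max_principle t0 T mu M (fun t x => 1 * v t x + (-1) * u t x)
  (fun t x => 1 * vt t x + (-1) * ut t x) (fun t x => 1 * vxx t x + (-1) * uxx t x)); auto.
- apply parab_lin; auto.
- apply Rlt_le, (kpp_mu _ _ Hf).
- intros s y Hs. specialize (Hb s y ltac:(lra)). specialize (Hpos s y Hs).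
  apply Rabs_le_between in Hb. lra.
- intro y. specialize (Hini y); lra.
- intros s y Hs Hn. rewrite (Heq s y) by lra.
  specialize (Hpos s y ltac:(lra)). specialize (Hsup s y Hs).
  pose proof (kpp_lip _ _ (v s y) (u s y) Hf ltac:(lra) ltac:(lra)). lra.
Qed.

(** The differential inequality is asked only where [u < v], hence where [v > 0]. A subsolution may
    thus become negative without being truncated. *)
Lemma subsolution_le (f : R -> R) (mu M t0 T Mv : R) (u ut uxx v vt vxx : R -> R -> R) :
  kpp f mu -> bounded_solution f M u ut uxx -> 0 <= t0 ->
  (forall t x, t0 <= t <= T -> 0 <= u t x) ->
  parab t0 T v vt vxx ->
  0 <= Mv -> (forall t x, t0 <= t <= T -> v t x <= Mv) ->
  (forall t x, t0 < t <= T -> u t x < v t x -> vt t x - vxx t x <= f (v t x)) ->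
  (forall x, v t0 x <= u t0 x) ->
  forall t x, t0 <= t <= T -> v t x <= u t x.
Proof.
intros Hf (Hu & Heq & HM & Hb) Ht0 Hpos Hv HMv Hvb Hsub Hini t x Ht.
assert (0 <= 1 * u t x + (-1) * v t x); [|lra].
apply (max_principle t0 T mu Mv (fun t x => 1 * u t x + (-1) * v t x)
  (fun t x => 1 * ut t x + (-1) * vt t x) (fun t x => 1 * uxx t x + (-1) * vxx t x)); auto.
- apply parab_lin; auto.
- apply Rlt_le, (kpp_mu _ _ Hf).
- intros s y Hs. specialize (Hvb s y Hs). specialize (Hpos s y Hs). lra.
- intro y. specialize (Hini y); lra.
- intros s y Hs Hn. rewrite (Heq s y) by lra.
  specialize (Hpos s y ltac:(lra)). specialize (Hsub s y Hs ltac:(lra)).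
  pose proof (kpp_lip _ _ (u s y) (v s y) Hf ltac:(lra) ltac:(lra)). lra.
Qed.

(** Below 0 the equation is linear, so the maximum principle applies directly; the constant 1 is a
    supersolution. *)
Lemma solution_range (f : R -> R) (mu M : R) (u ut uxx : R -> R -> R) :
  kpp f mu -> bounded_solution f M u ut uxx -> (forall x, 0 <= u 0 x <= 1) ->
  forall t x, 0 <= t -> 0 <= u t x <= 1.
Proof.
intros Hf Hs Hini t x Ht. split.
- destruct Hs as (Hu & Heq & HM & Hb).
  apply (max_principle 0 t mu M u ut uxx); auto; try lra.
  + apply Hu; lra.
  + apply Rlt_le, (kpp_mu _ _ Hf).
  + intros s y Hs. specialize (Hb s y ltac:(lra)). apply Rabs_le_between in Hb. lra.
  + intro y; apply Hini.
  + intros s y Hs Hn. rewrite (Heq s y) by lra. rewrite (kpp_neg _ _ Hf) by auto. lra.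
- apply (supersolution_ge f mu M 0 t u ut uxx (fun _ _ => 1) (fun _ _ => 0) (fun _ _ => 0));
    auto; try lra.
  + apply parab_const.
  + intros; lra.
  + intros; rewrite (kpp_1 _ _ Hf); lra.
  + intro y; apply Hini.
Qed.

(** Solves [w_t = w_xx + mu w]. The double sign and the final 0 reproduce the argument shape of
    [parab_wave]. *)
Definition lin_exp (mu b t x : R) : R := exp (b * x - - (b ^ 2 + mu) * t - 0).

Lemma parab_lin_exp (mu b t0 T : R) :
  parab t0 T (lin_exp mu b) (fun t x => (b ^ 2 + mu) * lin_exp mu b t x)
    (fun t x => b ^ 2 * lin_exp mu b t x).
Proof.
assert (H := parab_wave t0 T b (- (b ^ 2 + mu)) 0 exp exp exp is_derive_exp is_derive_exp).
rewrite Ropp_involutive in H. exact H.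
Qed.

Lemma parab_sandwich (f U : R -> R) (c k e B1 b1 B2 b2 mu s t0 T : R) :
  is_front f c U ->
  parab t0 T
    (fun t x => k * U (1 * x - c * t - s) + e * (B1 * lin_exp mu b1 t x + B2 * lin_exp mu b2 t x))
    (fun t x => k * (- c * Derive U (1 * x - c * t - s))
       + e * (B1 * ((b1 ^ 2 + mu) * lin_exp mu b1 t x) + B2 * ((b2 ^ 2 + mu) * lin_exp mu b2 t x)))
    (fun t x => k * (1 ^ 2 * Derive (Derive U) (1 * x - c * t - s))
       + e * (B1 * (b1 ^ 2 * lin_exp mu b1 t x) + B2 * (b2 ^ 2 * lin_exp mu b2 t x))).
Proof.
intros (_ & _ & D1 & D2 & _).
apply (parab_lin t0 T k e (fun t x => U (1 * x - c * t - s))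
  (fun t x => - c * Derive U (1 * x - c * t - s))
  (fun t x => 1 ^ 2 * Derive (Derive U) (1 * x - c * t - s))).
- apply (parab_wave t0 T 1 c s U (Derive U) (Derive (Derive U)));
    intro y; apply Derive_correct; auto.
- apply parab_lin; apply parab_lin_exp.
Qed.

(** Above, monotonicity of [f(s)/s] gives [f (k2 U) <= k2 f(U)], and adding [W] raises [f] by at
    most [mu W]. Below, where [v = k1 U - W > 0], one has [k1 f(U) <= f (k1 U)], and
    [f (k1 U) / (k1 U) <= f v / v <= mu] gives [f (k1 U) <= f v + mu W]. *)
Lemma front_sandwich (f U : R -> R) (mu M c : R) (u ut uxx : R -> R -> R)
    (k1 k2 B1 b1 B2 b2 s T : R) :
  kpp f mu -> is_front f c U -> bounded_solution f M u ut uxx ->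
  (forall x, 0 <= u 0 x <= 1) ->
  0 < k1 -> k1 <= 1 -> 1 <= k2 -> 0 < B1 -> 0 < B2 -> 0 <= T ->
  (forall x, k1 * U (x - s) - (B1 * exp (b1 * x) + B2 * exp (b2 * x)) <= u 0 x
    <= k2 * U (x - s) + (B1 * exp (b1 * x) + B2 * exp (b2 * x))) ->
  forall x,
    let w := B1 * exp (b1 * x + (b1 ^ 2 + mu) * T) + B2 * exp (b2 * x + (b2 ^ 2 + mu) * T) in
    k1 * U (x - c * T - s) - w <= u T x <= k2 * U (x - c * T - s) + w.
Proof.
intros Hf HU Hu Hr Hk1 Hk1' Hk2 HB1 HB2 HT Hini x w.
pose proof (kpp_mu _ _ Hf) as Hmu.
destruct (HU) as (HUr & _ & _ & _ & Hode & _).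
assert (HE : forall b t x, 0 < lin_exp mu b t x) by (intros; apply exp_pos).
assert (E0 : forall b y, lin_exp mu b 0 y = exp (b * y))
  by (intros; unfold lin_exp; f_equal; ring).
assert (ET : forall b y, lin_exp mu b T y = exp (b * y + (b ^ 2 + mu) * T))
  by (intros; unfold lin_exp; f_equal; ring).
assert (A0 : forall y, 1 * y - c * 0 - s = y - s) by (intro; ring).
assert (AT : 1 * x - c * T - s = x - c * T - s) by ring.
assert (HW : forall t y, 0 < B1 * lin_exp mu b1 t y + B2 * lin_exp mu b2 t y).
{ intros t y. pose proof (HE b1 t y). pose proof (HE b2 t y). nra. }
unfold w. rewrite <- !ET, <- AT. clear w. split.
- assert (H : k1 * U (1 * x - c * T - s) + (-1) * (B1 * lin_exp mu b1 T x + B2 * lin_exp mu b2 T x)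
     <= u T x); [|lra].
  refine (subsolution_le f mu M 0 T 1 u ut uxx _ _ _ Hf Hu (Rle_refl 0) _
    (parab_sandwich f U c k1 (-1) B1 b1 B2 b2 mu s 0 T HU) Rle_0_1 _ _ _ T x _); try lra.
  + intros t y Ht. apply (solution_range f mu M u ut uxx); auto; lra.
  + intros t y _. specialize (HW t y). pose proof (HUr (1 * y - c * t - s)). cbv beta. nra.
  + intros t y Ht Hlt. cbv beta in *.
    set (W := B1 * lin_exp mu b1 t y + B2 * lin_exp mu b2 t y) in *.
    set (xi := 1 * y - c * t - s) in *.
    assert (Hw : 0 < W) by apply HW.
    pose proof (proj1 (solution_range f mu M u ut uxx Hf Hu Hr t y ltac:(lra))).
    pose proof (HUr xi) as Hxi. specialize (Hode xi).
    set (v := k1 * U xi + (-1) * W) in *. assert (Hv : 0 < v) by lra.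
    assert (R1 := kpp_ratio _ _ Hf (k1 * U xi) (U xi) ltac:(nra) ltac:(nra)).
    assert (Hk : k1 * f (U xi) <= f (k1 * U xi)).
    { apply (Rmult_le_reg_r (U xi)); lra. }
    assert (Hvk : v <= k1 * U xi) by (unfold v; lra).
    assert (R2 := kpp_ratio _ _ Hf v (k1 * U xi) Hv Hvk).
    assert (R3 := kpp_le _ _ Hf v ltac:(lra)).
    assert (Hfk : f (k1 * U xi) <= f v + mu * W).
    { apply (Rmult_le_reg_r v); auto.
      replace (k1 * U xi) with (v + W) in R2 at 2 by (unfold v; ring). nra. }
    subst W. assert (k1 * (Derive (Derive U) xi + c * Derive U xi + f (U xi)) = 0) by (rewrite Hode; ring). lra.
  + intro y. cbv beta. rewrite !E0, A0. specialize (Hini y). lra.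
- assert (H : u T x <= k2 * U (1 * x - c * T - s) + 1 * (B1 * lin_exp mu b1 T x + B2 * lin_exp mu b2 T x));
    [|lra].
  refine (supersolution_ge f mu M 0 T u ut uxx _ _ _ Hf Hu (Rle_refl 0)
    (parab_sandwich f U c k2 1 B1 b1 B2 b2 mu s 0 T HU) _ _ _ T x _); try lra.
  + intros t y _. cbv beta. specialize (HW t y). pose proof (HUr (1 * y - c * t - s)). nra.
  + intros t y Ht. cbv beta.
    set (W := B1 * lin_exp mu b1 t y + B2 * lin_exp mu b2 t y) in *.
    set (xi := 1 * y - c * t - s) in *.
    assert (Hw : 0 < W) by apply HW.
    pose proof (HUr xi) as Hxi. specialize (Hode xi).
    assert (R1 := kpp_ratio _ _ Hf (U xi) (k2 * U xi) ltac:(lra) ltac:(nra)).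
    assert (Hk : f (k2 * U xi) <= k2 * f (U xi)).
    { apply (Rmult_le_reg_r (U xi)); lra. }
    assert (R2 := kpp_lip _ _ (k2 * U xi) (k2 * U xi + 1 * W) Hf ltac:(nra) ltac:(lra)).
    subst W. assert (k2 * (Derive (Derive U) xi + c * Derive U xi + f (U xi)) = 0) by (rewrite Hode; ring). lra.
  + intro y. cbv beta. rewrite !E0, A0. specialize (Hini y). lra.
Qed.

(** * Convergence ahead of the ray [x = (c - beta) t] *)

Lemma exp_le_compat (x y : R) : x <= y -> exp x <= exp y.
Proof.
intros [H| ->]; [left; apply exp_increasing; auto | lra].
Qed.

Lemma ln_le_linear (th : R) : 0 < th -> exists C, forall T, 0 < T -> ln T <= th * T + C.
Proof.
intros Hth. exists (- 1 - ln th). intros T HT.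
assert (H : 1 + ln (th * T) <= th * T).
{ assert (0 < th * T) by (apply Rmult_lt_0_compat; lra).
  destruct (Req_dec (ln (th * T)) 0) as [E|E].
  - rewrite E. rewrite <- (exp_ln (th * T)), E, exp_0; lra.
  - rewrite <- (exp_ln (th * T)) at 2 by auto. left; apply exp_ineq1; auto. }
rewrite ln_mult in H; lra.
Qed.

Lemma log_shift_sublinear (q s th : R) : 0 < th ->
  exists C, forall T, 1 <= T -> Rabs (q * ln T + s) <= th * T + C.
Proof.
intros Hth. pose proof (Rabs_pos q).
assert (Hq : 0 < th / (Rabs q + 1)) by (apply Rdiv_lt_0_compat; lra).
destruct (ln_le_linear _ Hq) as [C HC].
exists (Rabs q * Rabs C + Rabs s). intros T HT.
eapply Rle_trans; [apply Rabs_triang|]. rewrite Rabs_mult.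
assert (0 <= ln T).
{ rewrite <- ln_1. destruct (Req_dec 1 T) as [->|]; [lra|]. left; apply ln_increasing; lra. }
rewrite (Rabs_pos_eq (ln T)) by auto.
specialize (HC T ltac:(lra)). pose proof (Rle_abs C).
assert (Rabs q * ln T <= Rabs q * (th / (Rabs q + 1) * T + Rabs C)) by (apply Rmult_le_compat_l; lra).
assert (Rabs q * (th / (Rabs q + 1)) <= th).
{ replace th with ((Rabs q + 1) * (th / (Rabs q + 1))) at 2 by (field; lra).
  apply Rmult_le_compat_r; lra. }
assert (Rabs q * (th / (Rabs q + 1)) * T <= th * T) by (apply Rmult_le_compat_r; lra).
lra.
Qed.

Lemma front_tail_bound (f U : R -> R) (mu lam : R) :
  kpp f mu -> 0 < lam -> lam * lam < mu -> is_front f (lam + mu / lam) U ->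
  exists C, 0 < C /\ forall x, U x <= C * exp (- lam * x).
Proof.
intros Hf Hl Hlm HU.
destruct (front_asymptotics f U mu lam Hf Hl Hlm HU) as (A & HA & Has).
destruct (Has 1 Rlt_0_1) as [X HX].
exists (A + 1 + exp (lam * X)). pose proof (exp_pos (lam * X)).
split; [lra|]. intro x.
assert (E : forall y, U y = exp (lam * y) * U y * exp (- lam * y)).
{ intro y. rewrite Rmult_assoc, (Rmult_comm (U y)), <- Rmult_assoc, <- exp_plus.
  replace (lam * y + - lam * y) with 0 by ring. rewrite exp_0; ring. }
rewrite E. apply Rmult_le_compat_r; [left; apply exp_pos|].
destruct (Rle_dec X x) as [Hx|Hx].
- specialize (HX x Hx). apply Rabs_le_between in HX. lra.
- destruct HU as (HU & _). specialize (HU x).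
  assert (exp (lam * x) <= exp (lam * X)) by (apply exp_le_compat, Rmult_le_compat_l; lra).
  pose proof (exp_pos (lam * x)). nra.
Qed.

(** The power [x^nu] costs an arbitrarily slow exponential; the summand 1 serves the left side,
    where [exp (th * x)] vanishes. *)
Lemma initial_tail_bound (u0 : R -> R) (lam nu a X th : R) :
  0 < lam -> 0 < a -> 0 < th -> (forall x, 0 <= u0 x <= 1) ->
  (forall x, X < x -> u0 x = a * Rpower x nu * exp (- lam * x)) ->
  exists C, 0 < C /\ forall x, u0 x <= C * exp (- lam * x) * (1 + exp (th * x)).
Proof.
intros Hl Ha Hth Hr Has.
destruct (log_shift_sublinear nu 0 th Hth) as [C0 HC0].
set (X1 := Rmax X 1).
assert (HX1 : X <= X1) by apply Rmax_l. assert (HX1' : 1 <= X1) by apply Rmax_r. clearbody X1.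
pose proof (exp_pos (lam * X1)). pose proof (exp_pos C0).
assert (0 < a * exp C0) by (apply Rmult_lt_0_compat; auto).
exists (exp (lam * X1) + a * exp C0). split; [lra|]. intro x.
pose proof (exp_pos (- lam * x)). pose proof (exp_pos (th * x)).
destruct (Rle_dec x X1) as [Hx|Hx].
- assert (1 <= exp (lam * X1) * exp (- lam * x)).
  { rewrite <- exp_plus, <- exp_0. apply exp_le_compat. nra. }
  specialize (Hr x).
  assert (0 < exp (- lam * x) * (a * exp C0)) by (apply Rmult_lt_0_compat; auto).
  assert (0 < exp (- lam * x) * (exp (lam * X1) + a * exp C0) * exp (th * x))
    by (repeat apply Rmult_lt_0_compat; lra).
  lra.
- rewrite Has by lra. unfold Rpower.
  assert (exp (nu * ln x) <= exp C0 * exp (th * x)).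
  { rewrite <- exp_plus. apply exp_le_compat.
    specialize (HC0 x ltac:(lra)). apply Rabs_le_between in HC0. lra. }
  assert (a * exp (nu * ln x) * exp (- lam * x) <= a * (exp C0 * exp (th * x)) * exp (- lam * x)).
  { apply Rmult_le_compat_r; [lra|]. apply Rmult_le_compat_l; lra. }
  assert (0 < exp (lam * X1) * exp (- lam * x) * (1 + exp (th * x)))
    by (repeat apply Rmult_lt_0_compat; lra).
  assert (0 < a * exp C0 * exp (- lam * x)) by (apply Rmult_lt_0_compat; lra).
  lra.
Qed.

Lemma Rpower_near_1 (nu eps : R) : 0 < eps -> exists d, 0 < d < 1 /\
  forall r, Rabs (r - 1) <= d -> Rabs (Rpower r nu - 1) <= eps.
Proof.
intros He.
assert (D : is_derive (fun r => Rpower r nu) 1 (nu * (/ 1) * exp (nu * ln 1))).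
{ unfold Rpower. auto_derive; [lra|]. field. }
assert (Hc : continuity_pt (fun r => Rpower r nu) 1).
{ apply derivable_continuous_pt. eexists. apply is_derive_Reals, D. }
destruct (Hc eps He) as (d & Hd & H).
exists (Rmin (1 / 2) (d / 2)).
pose proof (Rmin_l (1 / 2) (d / 2)). pose proof (Rmin_r (1 / 2) (d / 2)).
split; [split; [apply Rmin_pos; lra|lra]|]. intros r Hr.
assert (E1 : Rpower 1 nu = 1) by (unfold Rpower; rewrite ln_1, Rmult_0_r, exp_0; auto).
destruct (Req_dec 1 r) as [<-|Hn].
{ rewrite E1, Rminus_diag_eq, Rabs_R0; lra. }
left. rewrite <- E1. apply (H r). split; [split; [exact I|exact Hn]|].
simpl. unfold Rdist. lra.
Qed.

Definition log_shift (lam nu sg T : R) : R := nu / lam * ln T + sg.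

(** With this constant the shift [s] at time [T] solves [A exp (- lam (x - s)) = a (d T)^nu exp (-
    lam x)]. *)
Definition limit_shift (lam nu a d A : R) : R := ln (a * Rpower d nu / A) / lam.

Lemma exp_log_shift (lam nu a d A T : R) :
  0 < lam -> 0 < a -> 0 < d -> 0 < A -> 0 < T ->
  exp (lam * log_shift lam nu (limit_shift lam nu a d A) T) = a / A * Rpower (d * T) nu.
Proof.
intros Hl Ha Hd HA HT. unfold log_shift, limit_shift.
replace (lam * (nu / lam * ln T + ln (a * Rpower d nu / A) / lam))
  with (nu * ln T + ln (a * Rpower d nu / A)) by (field; lra).
assert (0 < Rpower d nu) by apply exp_pos.
rewrite exp_plus, exp_ln.
- rewrite <- Rpower_mult_distr by lra. fold (Rpower T nu). field; lra.
- apply Rdiv_lt_0_compat; auto. apply Rmult_lt_0_compat; auto.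
Qed.

(** The window has width proportional to [T]: there [x / (d T)] is close to 1, so [x^nu] is nearly
    [(d T)^nu], while [x - s] tends to infinity and [U] is in its exponential tail. A tolerance
    [eps / 4] on each side leaves room for both products. *)
Lemma initial_front_match (U u0 : R -> R) (lam nu a d A X eps : R) :
  0 < lam -> 0 < a -> 0 < d -> 0 < A -> 0 < eps <= 1 ->
  (forall x, X < x -> u0 x = a * Rpower x nu * exp (- lam * x)) ->
  (forall e, 0 < e -> exists Y, forall x, Y <= x -> Rabs (exp (lam * x) * U x - A) <= e) ->
  exists de T0, 0 < de < d /\ 1 <= T0 /\
    forall T x, T0 <= T -> Rabs (x - d * T) <= de * T ->
      let s := log_shift lam nu (limit_shift lam nu a d A) T in
      (1 - eps) * U (x - s) <= u0 x <= (1 + eps) * U (x - s).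
Proof.
intros Hl Ha Hd HA He Has HU.
destruct (Rpower_near_1 nu (eps / 4)) as (r0 & Hr0 & Hr); [lra|].
destruct (HU (A * (eps / 4))) as [Y HY]; [apply Rmult_lt_0_compat; lra|].
assert (Hdd : 0 < (1 - r0) * d / 2) by (assert (0 < (1 - r0) * d) by (apply Rmult_lt_0_compat; lra); lra).
destruct (log_shift_sublinear (nu / lam) (limit_shift lam nu a d A) _ Hdd) as [C HC].
(* The window starts at [2 m T] and the shift uses at most [m T + C], so [x - s >= m T - C]. *)
set (m := (1 - r0) * d / 2) in *.
exists (r0 * d), (1 + (Rabs Y + Rabs C + Rabs X) / m + Rabs X / m).
assert (0 <= (Rabs Y + Rabs C + Rabs X) / m).
{ apply Rdiv_le_0_compat; auto. pose proof (Rabs_pos Y). pose proof (Rabs_pos C).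
  pose proof (Rabs_pos X). lra. }
assert (0 <= Rabs X / m) by (apply Rdiv_le_0_compat; auto; apply Rabs_pos).
split; [split; nra|]. split; [lra|]. intros T x HT Hx s.
assert (HmT : Rabs Y + Rabs C + Rabs X + m <= m * T).
{ replace (Rabs Y + Rabs C + Rabs X + m) with (m * (1 + (Rabs Y + Rabs C + Rabs X) / m))
    by (field; lra).
  apply Rmult_le_compat_l; lra. }
apply Rabs_le_between in Hx.
assert (Hx2 : 2 * m * T <= x) by (unfold m; lra).
pose proof (Rle_abs Y). pose proof (Rle_abs C). pose proof (Rle_abs X).
pose proof (Rabs_pos Y). pose proof (Rabs_pos C). pose proof (Rabs_pos X).
specialize (HC T ltac:(lra)). fold (log_shift lam nu (limit_shift lam nu a d A) T) in HC.
fold s in HC. apply Rabs_le_between in HC.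
specialize (HY (x - s) ltac:(lra)).
rewrite Has by lra.
assert (HdT : 0 < d * T) by (apply Rmult_lt_0_compat; lra).
assert (Er : x = d * T * (x / (d * T))) by (field; lra).
set (r := x / (d * T)) in *.
assert (Hrr : Rabs (r - 1) <= r0).
{ replace (r - 1) with ((x - d * T) / (d * T)) by (unfold r; field; lra).
  unfold Rdiv. rewrite Rabs_mult, (Rabs_pos_eq (/ (d * T))) by (left; apply Rinv_0_lt_compat; auto).
  apply (Rmult_le_reg_r (d * T)); auto. rewrite Rmult_assoc, Rinv_l, Rmult_1_r by lra.
  apply Rabs_le. lra. }
specialize (Hr r Hrr). apply Rabs_le_between in Hrr.
assert (Hr0' : 0 < r) by lra.
assert (Ep : Rpower x nu = Rpower (d * T) nu * Rpower r nu).
{ rewrite Er. symmetry. apply Rpower_mult_distr; auto. }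
rewrite Ep.
set (P := Rpower (d * T) nu). assert (HP : 0 < P) by apply exp_pos.
set (g := exp (lam * (x - s)) * U (x - s)) in *.
assert (EU : U (x - s) = exp (- lam * x) * (a / A * P) * g).
{ unfold P, g. rewrite <- (exp_log_shift lam nu a d A T) by lra. fold s.
  rewrite <- exp_plus, <- Rmult_assoc, <- exp_plus.
  replace (- lam * x + lam * s + lam * (x - s)) with 0 by ring. rewrite exp_0; ring. }
rewrite EU.
pose proof (exp_pos (- lam * x)) as Hex.
set (F := exp (- lam * x) * (a / A * P)).
assert (HaA : 0 < a / A) by (apply Rdiv_lt_0_compat; auto).
assert (HF : 0 < F) by (unfold F; apply Rmult_lt_0_compat; [auto|apply Rmult_lt_0_compat; auto]).
replace (a * (P * Rpower r nu) * exp (- lam * x)) with (F * (A * Rpower r nu))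
  by (unfold F; field; lra).
apply Rabs_le_between in HY. apply Rabs_le_between in Hr.
replace ((1 - eps) * (F * g)) with (F * ((1 - eps) * g)) by ring.
replace ((1 + eps) * (F * g)) with (F * ((1 + eps) * g)) by ring.
assert (A * (1 - eps / 4) <= A * Rpower r nu <= A * (1 + eps / 4))
  by (split; apply Rmult_le_compat_l; lra).
assert (Hg : A * (1 - eps / 4) <= g <= A * (1 + eps / 4)) by lra.
split; (apply Rmult_le_compat_l; [lra|]).
- assert ((1 - eps) * g <= (1 - eps) * (A * (1 + eps / 4))) by (apply Rmult_le_compat_l; lra).
  assert ((1 - eps) * (1 + eps / 4) <= 1 - eps / 4) by nra.
  assert (A * ((1 - eps) * (1 + eps / 4)) <= A * (1 - eps / 4)) by (apply Rmult_le_compat_l; lra).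
  lra.
- assert ((1 + eps) * (A * (1 - eps / 4)) <= (1 + eps) * g) by (apply Rmult_le_compat_l; lra).
  assert (1 + eps / 4 <= (1 + eps) * (1 - eps / 4)) by nra.
  assert (A * (1 + eps / 4) <= A * ((1 + eps) * (1 - eps / 4))) by (apply Rmult_le_compat_l; lra).
  lra.
Qed.

(* At time [T] the front is fed by the initial datum near [x = d T]; the two
   exponentials, with decay rates on either side of [lam], absorb the rest of
   the datum and are exponentially small in [T] when they reach the front. *)
Lemma convergence_ahead (f U : R -> R) (mu M lam nu a d A X : R) (u ut uxx : R -> R -> R) :
  kpp f mu -> 0 < lam -> lam * lam < mu -> d = mu / lam - lam ->
  is_front f (lam + mu / lam) U -> bounded_solution f M u ut uxx ->
  (forall x, 0 <= u 0 x <= 1) -> 0 < a -> 0 < A ->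
  (forall x, X < x -> u 0 x = a * Rpower x nu * exp (- lam * x)) ->
  (forall e, 0 < e -> exists Y, forall x, Y <= x -> Rabs (exp (lam * x) * U x - A) <= e) ->
  forall eps, 0 < eps -> exists beta T0, 0 < beta < lam + mu / lam /\ 1 <= T0 /\
    forall T x, T0 <= T -> (lam + mu / lam - beta) * T <= x ->
      Rabs (u T x - U (x - (lam + mu / lam) * T
        - log_shift lam nu (limit_shift lam nu a d A) T)) <= eps.
Proof.
intros Hf Hl Hlm Ed HU Hu Hr Ha HA Has Hasy eps Heps.
pose proof (kpp_mu _ _ Hf) as Hmu.
set (c := lam + mu / lam) in *.
assert (Elc : lam * c = lam * lam + mu) by (unfold c; field; lra).
assert (Edc : d = c - 2 * lam) by (unfold c; lra).
assert (Hd : 0 < d) by nra.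
assert (Hc : 0 < c) by lra.
set (e1 := Rmin 1 eps / 2).
assert (He1 : 0 < e1 < 1 /\ e1 <= eps / 2).
{ unfold e1. pose proof (Rmin_l 1 eps). pose proof (Rmin_r 1 eps).
  assert (0 < Rmin 1 eps) by (apply Rmin_pos; lra). lra. }
destruct (initial_front_match U (u 0) lam nu a d A X e1) as (de & T1 & Hde & HT1 & Hmid); auto; try lra.
(* The net exponent will be [eta^2 - eta * de], at most [- eta * de / 2]. Of this gain, [th] and
   [beta] each spend [eta * de / 8], which leaves the decay rate [eta * de / 4]; [eta <= lam / 2]
   keeps the rate [lam - eta] positive. *)
set (eta := Rmin (de / 2) (lam / 2)).
assert (Heta : 0 < eta) by (apply Rmin_pos; lra).
assert (Heta1 : eta <= de / 2) by apply Rmin_l.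
assert (Heta2 : eta <= lam / 2) by apply Rmin_r.
clearbody eta.
assert (Hed : 0 < eta * de) by (apply Rmult_lt_0_compat; lra).
set (th := eta * de / 8). assert (Hth : 0 < th) by (unfold th; lra).
(* Up to [(d + de) T <= 2 d T] the loss [exp (e0 * y)] is at most [exp (th * T)]; beyond,
   [e0 <= eta] lets the second exponential absorb its growth. *)
set (e0 := Rmin eta (th / (2 * d))).
assert (Hthd : 0 < th / (2 * d)) by (apply Rdiv_lt_0_compat; lra).
assert (He0 : 0 < e0) by (apply Rmin_pos; lra).
assert (He0a : e0 <= eta) by apply Rmin_l.
assert (He0b : e0 * (2 * d) <= th).
{ apply Rle_trans with (th / (2 * d) * (2 * d)); [|right; field; lra].
  apply Rmult_le_compat_r; [lra|apply Rmin_r]. }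
clearbody e0.
set (beta := Rmin (c / 2) (eta * de / (8 * (lam + eta)))).
assert (Hb0 : 0 < eta * de / (8 * (lam + eta))) by (apply Rdiv_lt_0_compat; lra).
assert (Hb1 : 0 < beta) by (apply Rmin_pos; lra).
assert (Hb2 : beta <= c / 2) by apply Rmin_l.
assert (Hb3 : (lam + eta) * beta <= eta * de / 8).
{ replace (eta * de / 8) with ((lam + eta) * (eta * de / (8 * (lam + eta)))) by (field; lra).
  apply Rmult_le_compat_l; [lra|apply Rmin_r]. }
clearbody beta.
destruct (front_tail_bound f U mu lam Hf Hl Hlm HU) as (C1 & HC1 & HUt).
destruct (initial_tail_bound (u 0) lam nu a X e0 Hl Ha He0 Hr Has) as (C2 & HC2 & Hut).
set (sg := limit_shift lam nu a d A) in *.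
assert (Hthl : 0 < th / lam) by (apply Rdiv_lt_0_compat; lra).
destruct (log_shift_sublinear (nu / lam) sg _ Hthl) as (C3 & HC3).
set (B := C1 * exp (lam * C3) + 2 * C2).
assert (HC1e : 0 < C1 * exp (lam * C3)) by (apply Rmult_lt_0_compat; [auto|apply exp_pos]).
assert (HB : 0 < B) by (unfold B; lra).
assert (Hq : 0 < eta * de / 4) by lra.
destruct (exp_decay (eta * de / 4) (2 * B) (eps / 2) Hq ltac:(lra)) as [T2 HT2].
exists beta, (Rmax T1 T2). split; [lra|].
split; [eapply Rle_trans; [exact HT1|apply Rmax_l]|].
intros T x HT Hx.
pose proof (Rmax_l T1 T2). pose proof (Rmax_r T1 T2).
specialize (HT2 T ltac:(lra)). specialize (HC3 T ltac:(lra)).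
fold (log_shift lam nu sg T) in HC3.
set (s := log_shift lam nu sg T) in *.
apply Rabs_le_between in HC3.
assert (HT0 : 1 <= T) by lra.
(* [B1] and [B2] make their exponentials equal to [B exp (th T) exp (- lam y)] at the left and right
   ends of the window respectively, so each dominates on its own side. *)
set (B1 := B * exp (th * T) * exp (eta * (d - de) * T)).
set (B2 := B * exp (th * T) * exp (- eta * (d + de) * T)).
assert (HB1 : 0 < B1) by (unfold B1; repeat apply Rmult_lt_0_compat; auto; apply exp_pos).
assert (HB2 : 0 < B2) by (unfold B2; repeat apply Rmult_lt_0_compat; auto; apply exp_pos).
assert (Hw0 : forall y, B1 * exp (- (lam + eta) * y) + B2 * exp (- (lam - eta) * y) =
   B * exp (th * T) * exp (- lam * y) * (exp (eta * ((d - de) * T - y)) + exp (eta * (y - (d + de) * T)))).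
{ intro y. unfold B1, B2. rewrite !Rmult_plus_distr_l, !Rmult_assoc, <- !exp_plus.
  f_equal; do 3 f_equal; ring. }
assert (HUs : forall y, U (y - s) <= C1 * exp (lam * C3) * exp (th * T) * exp (- lam * y)).
{ intro y. eapply Rle_trans; [apply HUt|]. rewrite !Rmult_assoc, <- !exp_plus.
  apply Rmult_le_compat_l; [lra|]. apply exp_le_compat.
  assert (lam * s <= lam * (th / lam * T + C3)) by (apply Rmult_le_compat_l; lra).
  replace (lam * (th / lam * T + C3)) with (th * T + lam * C3) in H1 by (field; lra). lra. }
assert (Hout : forall y, de * T < Rabs (y - d * T) ->
  U (y - s) <= B1 * exp (- (lam + eta) * y) + B2 * exp (- (lam - eta) * y) /\
  u 0 y <= B1 * exp (- (lam + eta) * y) + B2 * exp (- (lam - eta) * y)).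
{ intros y Hy. rewrite Hw0.
  set (P := exp (eta * ((d - de) * T - y))). set (Q := exp (eta * (y - (d + de) * T))).
  assert (HP : 0 < P) by apply exp_pos. assert (HQ : 0 < Q) by apply exp_pos.
  assert (HPQ : 1 <= P + Q).
  { rewrite <- exp_0. unfold Rabs in Hy. destruct (Rcase_abs (y - d * T)).
    - assert (exp 0 <= P); [|lra]. apply exp_le_compat, Rmult_le_pos; lra.
    - assert (exp 0 <= Q); [|lra]. apply exp_le_compat, Rmult_le_pos; lra. }
  set (K := exp (th * T) * exp (- lam * y)).
  assert (HK : 0 < K) by (unfold K; apply Rmult_lt_0_compat; apply exp_pos).
  replace (B * exp (th * T) * exp (- lam * y) * (P + Q)) with (K * (B * (P + Q))) by (unfold K; ring).
  split.
  - eapply Rle_trans; [apply HUs|].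
    replace (C1 * exp (lam * C3) * exp (th * T) * exp (- lam * y)) with (K * (C1 * exp (lam * C3)))
      by (unfold K; ring).
    apply Rmult_le_compat_l; [lra|]. unfold B. nra.
  - eapply Rle_trans; [apply Hut|].
    assert (Hexp : 1 + exp (e0 * y) <= 2 * exp (th * T) * (P + Q)).
    { assert (HthT : 1 <= exp (th * T)).
      { rewrite <- exp_0. apply exp_le_compat, Rmult_le_pos; lra. }
      assert (Hd2 : e0 * (d + de) * T <= th * T).
      { apply Rmult_le_compat_r; [lra|]. assert (e0 * (d + de) <= e0 * (2 * d))
          by (apply Rmult_le_compat_l; lra). lra. }
      assert (exp (e0 * y) <= exp (th * T) * (P + Q)).
      { unfold Rabs in Hy. destruct (Rcase_abs (y - d * T)).
        - assert (exp (e0 * y) <= exp (th * T)).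
          { apply exp_le_compat. assert (0 <= (d + de) * T - y) by nra.
            assert (0 <= e0 * ((d + de) * T - y)) by (apply Rmult_le_pos; lra). lra. }
          nra.
        - assert (exp (e0 * y) <= exp (th * T) * Q).
          { unfold Q. rewrite <- exp_plus. apply exp_le_compat.
            assert (0 <= (eta - e0) * (y - (d + de) * T)) by (apply Rmult_le_pos; lra). lra. }
          assert (0 < exp (th * T) * P) by (apply Rmult_lt_0_compat; lra). lra. }
      nra. }
    apply Rle_trans with (C2 * exp (- lam * y) * (2 * exp (th * T) * (P + Q))).
    { apply Rmult_le_compat_l; [|exact Hexp]. apply Rmult_le_pos; [lra|left; apply exp_pos]. }
    replace (C2 * exp (- lam * y) * (2 * exp (th * T) * (P + Q))) with (K * (2 * C2 * (P + Q)))
      by (unfold K; ring).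
    apply Rmult_le_compat_l; [lra|]. unfold B. nra. }
destruct (HU) as (HUr & _).
assert (HS := front_sandwich f U mu M c u ut uxx (1 - e1) (1 + e1) B1 (- (lam + eta)) B2 (- (lam - eta))
  s T Hf HU Hu Hr ltac:(lra) ltac:(lra) ltac:(lra) HB1 HB2 ltac:(lra)).
assert (Hini : forall y, (1 - e1) * U (y - s) -
      (B1 * exp (- (lam + eta) * y) + B2 * exp (- (lam - eta) * y)) <= u 0 y <=
      (1 + e1) * U (y - s) + (B1 * exp (- (lam + eta) * y) + B2 * exp (- (lam - eta) * y))).
{ intro y.
  assert (0 < B1 * exp (- (lam + eta) * y)) by (apply Rmult_lt_0_compat; [auto|apply exp_pos]).
  assert (0 < B2 * exp (- (lam - eta) * y)) by (apply Rmult_lt_0_compat; [auto|apply exp_pos]).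
  destruct (Rle_dec (Rabs (y - d * T)) (de * T)) as [Hy|Hy].
  - specialize (Hmid T y ltac:(lra) Hy). cbv zeta in Hmid. fold s in Hmid. lra.
  - destruct (Hout y ltac:(lra)). specialize (HUr (y - s)). specialize (Hr y). split; nra. }
specialize (HS Hini x). cbv zeta in HS.
assert (Hsmall : forall b, 0 < b -> b <= lam + eta -> - b * (x - c * T) <= eta * de / 8 * T).
{ intros b Hb Hb'. assert (- b * (x - c * T) <= b * beta * T) by nra.
  assert (b * beta <= (lam + eta) * beta) by (apply Rmult_le_compat_r; lra).
  assert (b * beta * T <= eta * de / 8 * T) by (apply Rmult_le_compat_r; lra). lra. }
assert (Hee : eta * eta <= eta * (de / 2)) by (apply Rmult_le_compat_l; lra).
assert (HeeT : eta * eta * T <= eta * (de / 2) * T) by (apply Rmult_le_compat_r; lra).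
(* Along [x = c T] the linear exponents are [eta^2 - eta d] and [eta^2 + eta d], because
   [d = c - 2 lam]; the prefactors cancel the [eta d] and leave [eta^2 - eta de] in both. *)
assert (Hwave : B1 * exp (- (lam + eta) * x + ((- (lam + eta)) ^ 2 + mu) * T) +
  B2 * exp (- (lam - eta) * x + ((- (lam - eta)) ^ 2 + mu) * T) <= 2 * B * exp (- (eta * de / 4) * T)).
{ assert (W1 : B1 * exp (- (lam + eta) * x + ((- (lam + eta)) ^ 2 + mu) * T) <=
     B * exp (- (eta * de / 4) * T)).
  { unfold B1. rewrite !Rmult_assoc, <- !exp_plus. apply Rmult_le_compat_l; [lra|].
    apply exp_le_compat. specialize (Hsmall (lam + eta) ltac:(lra) ltac:(lra)).
    replace (th * T + (eta * ((d - de) * T) + (- (lam + eta) * x + ((- (lam + eta)) ^ 2 + mu) * T)))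
      with (- (lam + eta) * (x - c * T) + th * T + (eta * eta - eta * de) * T
         + T * (lam * lam + mu - lam * c)) by (rewrite Edc; ring).
    rewrite Elc. unfold th. lra. }
  assert (W2 : B2 * exp (- (lam - eta) * x + ((- (lam - eta)) ^ 2 + mu) * T) <=
     B * exp (- (eta * de / 4) * T)).
  { unfold B2. rewrite !Rmult_assoc, <- !exp_plus. apply Rmult_le_compat_l; [lra|].
    apply exp_le_compat. specialize (Hsmall (lam - eta) ltac:(lra) ltac:(lra)).
    replace (th * T + (- eta * ((d + de) * T) + (- (lam - eta) * x + ((- (lam - eta)) ^ 2 + mu) * T)))
      with (- (lam - eta) * (x - c * T) + th * T + (eta * eta - eta * de) * T
         + T * (lam * lam + mu - lam * c)) by (rewrite Edc; ring).
    rewrite Elc. unfold th. lra. }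
  lra. }
specialize (HUr (x - c * T - s)).
apply Rabs_le. split; nra.
Qed.

(** * Invasion behind the ray *)

Lemma Rabs_le_of_sqr (x r : R) : 0 <= r -> x ^ 2 <= r ^ 2 -> Rabs x <= r.
Proof.
intros Hr H. apply Rabs_le. split; nra.
Qed.

(* The subsolution [m (1 - xi^2/R^2)^3], [xi = x - y - v (t - t0)], is negative
   outside its window, so no cut-off is needed. *)
Lemma persistence (f : R -> R) (mu M : R) (u ut uxx : R -> R -> R) :
  kpp f mu -> bounded_solution f M u ut uxx -> (forall x, 0 <= u 0 x <= 1) ->
  exists kap Rw v0, 0 < kap /\ 0 < Rw /\ 0 < v0 /\
    forall t0 y m tau v, 0 <= t0 -> 0 < m <= kap ->
      (forall x, Rabs (x - y) <= Rw -> m <= u t0 x) ->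
      0 <= tau -> Rabs v <= v0 -> m <= u (t0 + tau) (y + v * tau).
Proof.
intros Hf Hu Hr.
pose proof (kpp_mu _ _ Hf) as Hmu.
destruct (kpp_half _ _ Hf) as (s0 & Hs0 & Hhalf).
assert (H27 : 0 < 27 / mu) by (apply Rdiv_lt_0_compat; lra).
set (r := 27 / mu + 1).
assert (Hr1 : 1 <= r) by (unfold r; lra).
assert (Hr2 : 27 <= mu * r ^ 2).
{ assert (mu * r = 27 + mu) by (unfold r; field; lra). nra. }
clearbody r.
(* Together the two bounds give [v0^2 <= mu / 3], so the transport term uses only half of the
   available [mu / 2 * q^2]. *)
set (v0 := Rmin 1 (mu / 3)).
assert (Hv0 : 0 < v0) by (apply Rmin_pos; lra).
assert (Hv1 : v0 <= 1) by apply Rmin_l.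
assert (Hv2 : v0 <= mu / 3) by apply Rmin_r.
clearbody v0.
exists s0, r, v0. split; [lra|split; [lra|split; [lra|]]].
intros t0 y m tau v Ht0 Hm Hwin Htau Hv.
assert (Hpos : forall t x, 0 <= t -> 0 <= u t x)
  by (intros; apply (solution_range f mu M u ut uxx); auto).
set (h := m / r ^ 6).
assert (Hr6 : 0 < r ^ 6) by (apply pow_lt; lra).
assert (Hh : 0 < h) by (unfold h; apply Rdiv_lt_0_compat; lra).
assert (Ehm : h * r ^ 6 = m) by (unfold h; field; lra).
(* The power is odd for negativity outside the window, and above 1 so that near the edge, where [p]
   vanishes, positive curvature beats transport. *)
pose (p := fun z => h * (r ^ 2 - z ^ 2) ^ 3).
pose (p1 := fun z => h * (3 * (r ^ 2 - z ^ 2) ^ 2 * (- 2 * z))).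
pose (p2 := fun z => h * (24 * z ^ 2 * (r ^ 2 - z ^ 2) - 6 * (r ^ 2 - z ^ 2) ^ 2)).
assert (D1 : forall z, is_derive p z (p1 z)).
{ intro z. unfold p, p1. auto_derive; auto. ring. }
assert (D2 : forall z, is_derive p1 z (p2 z)).
{ intro z. unfold p1, p2. auto_derive; auto. ring. }
assert (Hp_le : forall z, p z <= m).
{ intro z. rewrite <- Ehm. unfold p. apply Rmult_le_compat_l; [lra|].
  replace (r ^ 6) with ((r ^ 2) ^ 3) by ring.
  destruct (Rle_dec 0 (r ^ 2 - z ^ 2)).
  - apply pow_incr. nra.
  - assert ((r ^ 2 - z ^ 2) ^ 3 <= 0).
    { replace ((r ^ 2 - z ^ 2) ^ 3) with (- ((z ^ 2 - r ^ 2) ^ 3)) by ring.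
      assert (0 <= (z ^ 2 - r ^ 2) ^ 3) by (apply pow_le; lra). lra. }
    assert (0 <= (r ^ 2) ^ 3) by (apply pow_le; nra). lra. }
assert (Hp_pos : forall z, 0 < p z -> 0 < r ^ 2 - z ^ 2).
{ intros z Hz. apply Rnot_le_lt; intro Hn. unfold p in Hz.
  assert (0 <= (z ^ 2 - r ^ 2) ^ 3) by (apply pow_le; lra).
  assert (0 <= h * (z ^ 2 - r ^ 2) ^ 3) by (apply Rmult_le_pos; lra).
  replace (h * (r ^ 2 - z ^ 2) ^ 3) with (- (h * (z ^ 2 - r ^ 2) ^ 3)) in Hz by ring. lra. }
assert (Hsub : p (1 * (y + v * tau) - v * (t0 + tau) - (y - v * t0)) <= u (t0 + tau) (y + v * tau)).
{ refine (subsolution_le f mu M t0 (t0 + tau) m u ut uxx _ _ _ Hf Hu Ht0 _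
    (parab_wave t0 (t0 + tau) 1 v (y - v * t0) p p1 p2 D1 D2) _ _ _ _
    (t0 + tau) (y + v * tau) _); try lra.
  - intros t x Ht. apply Hpos; lra.
  - intros t x _. apply Hp_le.
  - intros t x Ht Hlt. cbv beta in *. set (z := 1 * x - v * t - (y - v * t0)) in *.
    assert (Hpz : 0 < p z) by (specialize (Hpos t x ltac:(lra)); lra).
    specialize (Hp_le z). specialize (Hhalf (p z) ltac:(lra)). specialize (Hp_pos z Hpz).
    eapply Rle_trans; [|exact Hhalf]. unfold p, p1, p2.
    assert (Ez : z ^ 2 = r ^ 2 - (r ^ 2 - z ^ 2)) by ring.
    set (q := r ^ 2 - z ^ 2) in *.
    assert (Hvv : v ^ 2 <= mu / 3).
    { assert (v ^ 2 <= v0 ^ 2).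
      { rewrite <- (pow2_abs v). apply pow_incr. split; [apply Rabs_pos|auto]. }
      nra. }
    (* Young: [6 v z q <= 12 z^2 + 3/4 v^2 q^2]; then a quadratic in [q] with
       nonpositive discriminant since [mu r^2 >= 27]. *)
    assert (Hy : 6 * v * z * q <= 12 * z ^ 2 + 3 / 4 * v ^ 2 * q ^ 2).
    { assert (0 <= 3 * (2 * z - v * q / 2) ^ 2) by (pose proof (pow2_ge_0 (2 * z - v * q / 2)); lra).
      lra. }
    assert (Hvq : v ^ 2 * q ^ 2 <= mu / 3 * q ^ 2).
    { apply Rmult_le_compat_r; [apply pow2_ge_0|auto]. }
    assert (Hquad : 0 <= mu / 4 * q ^ 2 - 18 * q + 12 * r ^ 2).
    { apply (Rmult_le_reg_l mu); [auto|]. pose proof (pow2_ge_0 (mu * q / 2 - 18)). nra. }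
    assert (Hk : 6 * v * z * q - 24 * z ^ 2 + 6 * q <= mu / 2 * q ^ 2) by lra.
    assert (Hhq : 0 <= h * q) by (apply Rmult_le_pos; lra).
    apply (Rmult_le_compat_l (h * q)) in Hk; auto.
    replace (1 ^ 2 * (h * (24 * z ^ 2 * q - 6 * q ^ 2)))
      with (h * q * (24 * z ^ 2 - 6 * q)) by ring.
    replace (- v * (h * (3 * q ^ 2 * (-2 * z)))) with (h * q * (6 * v * z * q)) by ring.
    replace (mu / 2 * (h * q ^ 3)) with (h * q * (mu / 2 * q ^ 2)) by ring. lra.
  - intro x. replace (1 * x - v * t0 - (y - v * t0)) with (x - y) by ring.
    destruct (Rle_dec (Rabs (x - y)) r) as [Hx|Hx].
    + specialize (Hp_le (x - y)). specialize (Hwin x Hx). lra.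
    + apply Rle_trans with 0; [|apply Hpos; lra].
      apply Rnot_lt_le; intro Hp. apply Hx. apply Rabs_le_of_sqr; [lra|].
      specialize (Hp_pos _ Hp). lra. }
replace (1 * (y + v * tau) - v * (t0 + tau) - (y - v * t0)) with 0 in Hsub by ring.
replace (p 0) with m in Hsub; auto. rewrite <- Ehm. unfold p. ring.
Qed.

(** The subsolution is the rising parabola [m + k (t - t0) - (k/2) (x - x0)^2], whose heat operator
    is [2 k]. Where it exceeds [u] inside the window it takes values in [[m, 1 - eps]], where
    [f >= 2 k]; outside it is negative, having lost at least 1. *)
Lemma local_rise (f : R -> R) (mu M m eps : R) (u ut uxx : R -> R -> R) :
  kpp f mu -> bounded_solution f M u ut uxx -> (forall x, 0 <= u 0 x <= 1) ->
  0 < m -> 0 < eps < 1 ->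
  exists tau L, 0 < tau /\ 0 < L /\ forall t0 x0, 0 <= t0 ->
    (forall t x, t0 <= t <= t0 + tau -> Rabs (x - x0) <= L -> m <= u t x) ->
    1 - eps <= u (t0 + tau) x0.
Proof.
intros Hf Hu Hr Hm He.
assert (Hpos : forall t x, 0 <= t -> 0 <= u t x)
  by (intros; apply (solution_range f mu M u ut uxx); auto).
destruct (Rle_dec (1 - eps) m) as [Hle|Hlt].
{ exists 1, 1. split; [lra|split; [lra|]]. intros t0 x0 Ht0 H.
  specialize (H (t0 + 1) x0 ltac:(lra)). rewrite Rminus_diag_eq, Rabs_R0 in H by auto.
  specialize (H ltac:(lra)). lra. }
assert (Hfe : 0 < f (1 - eps)) by (apply (kpp_pos _ _ Hf); lra).
set (k := f (1 - eps) * m / 2).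
assert (Hk : 0 < k) by (unfold k; assert (0 < f (1 - eps) * m) by (apply Rmult_lt_0_compat; auto); lra).
assert (Hfk : forall s, m <= s <= 1 - eps -> 2 * k <= f s).
{ intros s Hs. pose proof (kpp_ratio _ _ Hf s (1 - eps) ltac:(lra) ltac:(lra)).
  assert (0 < f s) by (apply (kpp_pos _ _ Hf); lra). unfold k. nra. }
clearbody k.
set (tau := (1 - eps - m) / k).
assert (Htau : 0 < tau) by (unfold tau; apply Rdiv_lt_0_compat; lra).
assert (Ekt : k * tau = 1 - eps - m) by (unfold tau; field; lra).
clearbody tau.
assert (H2k : 0 < 2 / k) by (apply Rdiv_lt_0_compat; lra).
set (L := 1 + 2 / k). assert (HL : 1 <= L) by (unfold L; lra).
assert (HkL : 2 <= k * L) by (unfold L; replace (k * (1 + 2 / k)) with (k + 2) by (field; lra); lra).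
clearbody L.
assert (HkL2 : 1 <= k / 2 * L ^ 2) by nra.
exists tau, L. split; [lra|split; [lra|]]. intros t0 x0 Ht0 Hwin.
assert (Hout : forall x, ~ Rabs (x - x0) <= L -> 1 <= k / 2 * (x - x0) ^ 2).
{ intros x Hx. eapply Rle_trans; [exact HkL2|]. apply Rmult_le_compat_l; [lra|].
  rewrite <- (pow2_abs (x - x0)). apply pow_incr. lra. }
assert (P : parab t0 (t0 + tau)
  (fun t x => 1 * (m + k * (0 * x - (-1) * t - t0)) + 1 * (- (k / 2) * (1 * x - 0 * t - x0) ^ 2))
  (fun t x => 1 * (- (-1) * k) + 1 * (- 0 * (- k * (1 * x - 0 * t - x0))))
  (fun t x => 1 * (0 ^ 2 * 0) + 1 * (1 ^ 2 * (- k)))).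
{ apply parab_lin.
  - apply (parab_wave t0 (t0 + tau) 0 (-1) t0 (fun z => m + k * z) (fun _ => k) (fun _ => 0));
      intro; auto_derive; auto; ring.
  - apply (parab_wave t0 (t0 + tau) 1 0 x0 (fun z => - (k / 2) * z ^ 2) (fun z => - k * z) (fun _ => - k));
      intro; auto_derive; auto; field. }
assert (H : 1 * (m + k * (0 * x0 - (-1) * (t0 + tau) - t0)) +
   1 * (- (k / 2) * (1 * x0 - 0 * (t0 + tau) - x0) ^ 2) <= u (t0 + tau) x0); [|lra].
assert (Hup : forall t x, t0 <= t <= t0 + tau ->
  1 * (m + k * (0 * x - (-1) * t - t0)) + 1 * (- (k / 2) * (1 * x - 0 * t - x0) ^ 2)
    <= 1 - eps - k / 2 * (x - x0) ^ 2).
{ intros t x Ht. assert (k * (t - t0) <= k * tau) by (apply Rmult_le_compat_l; lra).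
  replace (1 * x - 0 * t - x0) with (x - x0) by ring. lra. }
refine (subsolution_le f mu M t0 (t0 + tau) 1 u ut uxx _ _ _ Hf Hu Ht0 _ P _ _ _ _
  (t0 + tau) x0 _); try lra.
- intros t x Ht. apply Hpos; lra.
- intros t x Ht. specialize (Hup t x Ht). cbv beta.
  assert (0 <= k / 2 * (x - x0) ^ 2) by (apply Rmult_le_pos; [lra|apply pow2_ge_0]). lra.
- intros t x Ht Hlt'. cbv beta in Hlt'.
  specialize (Hup t x ltac:(lra)).
  assert (0 <= k / 2 * (x - x0) ^ 2) by (apply Rmult_le_pos; [lra|apply pow2_ge_0]).
  destruct (Rle_dec (Rabs (x - x0)) L) as [Hx|Hx].
  + specialize (Hwin t x ltac:(lra) Hx).
    eapply Rle_trans; [|apply Hfk]; [lra|]. cbv beta. lra.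
  + specialize (Hout x Hx). specialize (Hpos t x ltac:(lra)). lra.
- intro x. specialize (Hup t0 x ltac:(lra)). cbv beta.
  destruct (Rle_dec (Rabs (x - x0)) L) as [Hx|Hx].
  + specialize (Hwin t0 x ltac:(lra) Hx).
    assert (0 <= k / 2 * (x - x0) ^ 2) by (apply Rmult_le_pos; [lra|apply pow2_ge_0]).
    replace (1 * x - 0 * t0 - x0) with (x - x0) by ring. lra.
  + specialize (Hout x Hx). specialize (Hpos t0 x ltac:(lra)). lra.
Qed.

(** A far point [x] was crossed at time [x / q] by the window with [u >= 1/2], and persistence at
    speed 0 keeps [u >= m] there. A near point is reached by the initial bump at speed
    [(x - y0) / t], admissible for large [t]. Then [local_rise] lifts [m] to [1 - eps]. *)
Lemma convergence_behind (f : R -> R) (mu M c beta T1 X : R) (u ut uxx : R -> R -> R) :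
  kpp f mu -> bounded_solution f M u ut uxx -> (forall x, 0 <= u 0 x <= 1) ->
  (forall x, continuity_pt (u 0) x) -> (forall x, X < x -> 0 < u 0 x) ->
  0 < beta < c -> 0 <= T1 ->
  (forall s x, T1 <= s -> (c - beta) * s <= x <= (c - beta / 2) * s -> 1 / 2 <= u s x) ->
  forall eps, 0 < eps < 1 -> exists T, forall t x, T <= t -> 0 <= x <= (c - beta) * t ->
    1 - eps <= u t x.
Proof.
intros Hf Hu Hr Hcont Hpos Hb HT1 Hray eps He.
destruct (persistence f mu M u ut uxx Hf Hu Hr) as (kap & r & v0 & Hkap & Hrp & Hv0 & Hpers).
set (y0 := X + r + 1).
destruct (continuity_ab_min (u 0) (y0 - r) (y0 + r)) as (xm & Hxm & Hxm'); [lra|auto|].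
assert (Hm0 : 0 < u 0 xm) by (apply Hpos; unfold y0 in *; lra).
set (m := Rmin kap (Rmin (u 0 xm) (1 / 2))).
assert (Hm : 0 < m) by (repeat apply Rmin_pos; lra).
assert (Hmk : m <= kap) by apply Rmin_l.
assert (Hmm : m <= Rmin (u 0 xm) (1 / 2)) by apply Rmin_r.
pose proof (Rmin_l (u 0 xm) (1 / 2)). pose proof (Rmin_r (u 0 xm) (1 / 2)).
clearbody m.
destruct (local_rise f mu M m eps u ut uxx Hf Hu Hr Hm He) as (tau & L & Htau & HL & Hrise).
(* Midway between the speeds [c - beta] and [c - beta / 2], so at time [s] a margin [beta / 4 * s]
   is free on both sides; [s0] makes it at least [r]. *)
set (q := c - 3 / 4 * beta). assert (Hq : 0 < q) by (unfold q; lra).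
set (s0 := Rmax T1 (4 * r / beta)).
assert (Hs0 : T1 <= s0) by apply Rmax_l.
assert (Hs0' : 4 * r / beta <= s0) by apply Rmax_r.
assert (Hs0r : r <= beta / 4 * s0).
{ replace r with (beta / 4 * (4 * r / beta)) by (field; lra).
  apply Rmult_le_compat_l; lra. }
clearbody s0.
set (T2 := (L + q * s0 + Rabs y0) / v0).
assert (Hqs : 0 <= q * s0) by (apply Rmult_le_pos; lra).
pose proof (Rabs_pos y0).
assert (HT2 : 0 < T2) by (unfold T2; apply Rdiv_lt_0_compat; lra).
assert (ET2 : v0 * T2 = L + q * s0 + Rabs y0) by (unfold T2; field; lra).
clearbody T2.
(* The range starts at [- L] because windows of radius [L] centred at [x >= 0] must fit in it. *)
assert (Hlow : forall t x, T2 <= t -> - L <= x <= q * t -> m <= u t x).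
{ intros t x Ht Hx. destruct (Rle_dec (q * s0) x) as [Hx0|Hx0].
  - set (s := x / q). assert (Es : q * s = x) by (unfold s; field; lra).
    clearbody s.
    assert (Hs : s0 <= s) by (apply (Rmult_le_reg_l q); lra).
    assert (Hst : s <= t) by (apply (Rmult_le_reg_l q); lra).
    assert (Hrs : r <= beta / 4 * s).
    { eapply Rle_trans; [exact Hs0r|]. apply Rmult_le_compat_l; lra. }
    assert (P := Hpers s x m (t - s) 0 ltac:(lra) ltac:(lra)).
    rewrite Rabs_R0 in P.
    replace (s + (t - s)) with t in P by ring. replace (x + 0 * (t - s)) with x in P by ring.
    apply P; try lra. intros z Hz. apply Rabs_le_between in Hz.
    assert (1 / 2 <= u s z); [|lra]. apply Hray; [lra|]. unfold q in Es. lra.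
  - assert (P := Hpers 0 y0 m t ((x - y0) / t) ltac:(lra) ltac:(lra)).
    replace (0 + t) with t in P by ring.
    replace (y0 + (x - y0) / t * t) with x in P by (field; lra).
    apply P; try lra.
    + intros z Hz. apply Rabs_le_between in Hz.
      specialize (Hxm z ltac:(lra)). lra.
    + unfold Rdiv. rewrite Rabs_mult, (Rabs_pos_eq (/ t)) by (left; apply Rinv_0_lt_compat; lra).
      apply (Rmult_le_reg_r t); [lra|]. rewrite Rmult_assoc, Rinv_l, Rmult_1_r by lra.
      assert (v0 * T2 <= v0 * t) by (apply Rmult_le_compat_l; lra).
      pose proof (Rle_abs y0). pose proof (Rle_abs (- y0)). rewrite Rabs_Ropp in *.
      apply Rabs_le. lra. }
(* Ensures [(c - beta) t + L <= q (t - tau)], so the window stays below the ray of speed [q]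
   throughout the rise. *)
set (T3 := (L + q * tau) / (beta / 4)).
assert (Hqt : 0 < q * tau) by (apply Rmult_lt_0_compat; lra).
assert (HT3 : 0 < T3) by (unfold T3; apply Rdiv_lt_0_compat; lra).
assert (ET3 : beta / 4 * T3 = L + q * tau) by (unfold T3; field; lra).
clearbody T3.
exists (T2 + tau + T3). intros t x Ht Hx.
assert (H2 := Hrise (t - tau) x ltac:(lra)).
replace (t - tau + tau) with t in H2 by ring. apply H2.
intros s z Hs Hz. apply Rabs_le_between in Hz. apply Hlow; [lra|]. split; [lra|].
assert (beta / 4 * T3 <= beta / 4 * t) by (apply Rmult_le_compat_l; lra).
assert (q * (t - tau) <= q * s) by (apply Rmult_le_compat_l; lra).
unfold q in *. lra.
Qed.

Lemma front_near_1 (f U : R -> R) (c b q sg eps : R) :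
  is_front f c U -> 0 < b -> 0 < eps ->
  exists T, 1 <= T /\ forall t x, T <= t -> x <= (c - b) * t ->
    1 - eps <= U (x - c * t - (q * ln t + sg)).
Proof.
intros (_ & _ & _ & _ & _ & Hm & _) Hb He.
apply is_lim_spec in Hm. destruct (Hm (mkposreal eps He)) as [Y HY]. simpl in HY.
(* The logarithm uses up only half of the linear gap [b t], so the argument of [U] still tends to
   minus infinity. *)
destruct (log_shift_sublinear q sg (b / 2)) as [C HC]; [lra|].
set (T := (Rabs C + Rabs Y + 1) / (b / 2)).
pose proof (Rabs_pos C). pose proof (Rabs_pos Y).
assert (HT : 0 < T) by (unfold T; apply Rdiv_lt_0_compat; lra).
assert (ET : b / 2 * T = Rabs C + Rabs Y + 1) by (unfold T; field; lra).
clearbody T. exists (1 + T). split; [lra|]. intros t x Ht Hx.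
specialize (HC t ltac:(lra)). apply Rabs_le_between in HC.
assert (b / 2 * T <= b / 2 * t) by (apply Rmult_le_compat_l; lra).
pose proof (Rle_abs C). pose proof (Rle_abs (- Y)). rewrite Rabs_Ropp in *.
specialize (HY (x - c * t - (q * ln t + sg)) ltac:(lra)).
apply Rabs_def2 in HY. lra.
Qed.

Theorem theorem1p5
  (g : R -> R) (lambda : R) (U u0 : R -> R) (nu a : R) (u : R -> R -> R) :
  C2_on_R g ->
  g 0 = 0 -> g 1 = 0 ->
  (forall s, 0 < s < 1 -> 0 < g s <= Derive g 0 * s) ->
  (forall s t, 0 < s -> s <= t -> t <= 1 -> g t / t <= g s / s) ->
  0 < lambda -> lambda < sqrt (Derive g 0) ->
  is_front (lin_ext g) (lambda + Derive g 0 / lambda) U ->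
  (forall x, continuity_pt u0 x) ->
  (forall x, 0 <= u0 x <= 1) ->
  (exists x, u0 x <> 0) ->
  0 < a ->
  (exists X, 0 < X /\
     forall x, X < x -> u0 x = a * Rpower x nu * exp (- lambda * x)) ->
  classical_solution (lin_ext g) u0 u ->
  exists sigma_inf : R,
    forall eps, 0 < eps -> exists T, 0 < T /\
      forall t x, T < t -> 0 <= x ->
        Rabs (u t x - U (x - (lambda + Derive g 0 / lambda) * t
                           - nu / lambda * ln t - sigma_inf)) <= eps.
Proof.
intros HC2 g0 g1 Hb Hratio Hl Hls HU Hcont Hr _ Ha (X & _ & Has) Hsol.
assert (Hf := lin_ext_kpp g HC2 g0 g1 Hb Hratio).
set (f := lin_ext g) in *. set (mu := Derive g 0) in *.
pose proof (kpp_mu _ _ Hf) as Hmu.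
assert (Hlm : lambda * lambda < mu).
{ rewrite <- (sqrt_sqrt mu) by lra. apply Rmult_le_0_lt_compat; lra. }
assert (Hu0 : u 0 = u0).
{ apply functional_extensionality. apply Hsol. }
destruct (classical_bounded_solution f u0 u Hsol) as (M & ut & uxx & Hu).
rewrite <- Hu0 in *.
destruct (front_asymptotics f U mu lambda Hf Hl Hlm HU) as (A & HA & Hasy).
set (d := mu / lambda - lambda).
set (sg := limit_shift lambda nu a d A).
exists sg. intros eps He.
(* On the wedge between speeds [c - beta] and [c - beta / 2] both estimates combine to
   [u >= 1 - 2 e], and [e <= 1/4] makes this at least [1/2]. *)
set (e := Rmin eps (1 / 4)).
assert (He0 : 0 < e) by (apply Rmin_pos; lra).
assert (He1 : e <= eps) by apply Rmin_l. assert (He2 : e <= 1 / 4) by apply Rmin_r.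
clearbody e.
destruct (convergence_ahead f U mu M lambda nu a d A X u ut uxx Hf Hl Hlm eq_refl HU Hu Hr Ha HA
  Has Hasy e He0) as (beta & T0 & Hbeta & HT0 & Hahead).
fold sg in Hahead.
set (c := lambda + mu / lambda) in *.
destruct (front_near_1 f U c (beta / 2) (nu / lambda) sg e HU ltac:(lra) He0) as (T1 & HT1 & Hnear).
assert (HX : forall x, X < x -> 0 < u 0 x).
{ intros x Hx. rewrite Has by auto.
  apply Rmult_lt_0_compat; [apply Rmult_lt_0_compat; [auto|]|]; apply exp_pos. }
destruct (convergence_behind f mu M c beta (Rmax T0 T1) X u ut uxx Hf Hu Hr Hcont HX Hbeta)
  with (eps := e) as (T2 & Hbehind).
- pose proof (Rmax_l T0 T1). lra.
- intros s x Hs Hx. pose proof (Rmax_l T0 T1). pose proof (Rmax_r T0 T1).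
  specialize (Hahead s x ltac:(lra) ltac:(lra)). specialize (Hnear s x ltac:(lra) ltac:(lra)).
  unfold log_shift in Hahead. apply Rabs_le_between in Hahead. lra.
- lra.
- exists (Rmax (Rmax T0 T1) T2).
  pose proof (Rmax_l (Rmax T0 T1) T2). pose proof (Rmax_r (Rmax T0 T1) T2).
  pose proof (Rmax_l T0 T1). pose proof (Rmax_r T0 T1).
  split; [lra|]. intros t x Ht Hx.
  replace (x - c * t - nu / lambda * ln t - sg) with (x - c * t - (nu / lambda * ln t + sg)) by ring.
  destruct (Rle_dec ((c - beta) * t) x) as [Hc|Hc].
  + specialize (Hahead t x ltac:(lra) Hc). unfold log_shift in Hahead. lra.
  + specialize (Hbehind t x ltac:(lra) ltac:(lra)).
    assert (Hn : x <= (c - beta / 2) * t) by nra.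
    specialize (Hnear t x ltac:(lra) Hn).
    pose proof (solution_range f mu M u ut uxx Hf Hu Hr t x ltac:(lra)).
    destruct HU as (HUr & _). specialize (HUr (x - c * t - (nu / lambda * ln t + sg))).
    apply Rabs_le. lra.
Qed.
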